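(* Let $\overline{M}$ be a complex space form of real dimension $n+p$, with Kaehler structure $(J,\overline{g})$ and constant holomorphic sectional curvature $4c$, and let $M$ be an $n$-dimensional $CR$ submanifold of maximal $CR$ dimension in $\overline{M}$, where $n\geq 3$. Suppose $p<n$, and let $A$ be the shape operator of the distinguished unit normal vector field $\xi$ of $M$. If $\nabla A=0$ on $M$, then $\overline{M}$ is a Euclidean space, in the sense that $c=0$.
   Context: A complex space form is a Kaehler manifold $\overline{M}$ with complex structure $J$ and Kaehler metric $\overline{g}$, of constant holomorphic sectional curvature, denoted $4c$ with $c\in\mathbb{R}$. All dimensions of manifolds are real dimensions, and $n,p$ are positive integers. Let $M$ be an $n$-dimensional real submanifold immersed in $\overline{M}$, with the induced Riemannian metric $g$. For $x\in M$ put $H_x(M)=JT_x(M)\cap T_x(M)$, the maximal $J$-invariant subspace of $T_x(M)$. $M$ is called a $CR$ submanifold of maximal $CR$ dimension if $\dim_{\mathbb{C}}H_x(M)=\frac{n-1}{2}$ for every $x\in M$ (so $n$ is odd). In this case there is a unit vector field $\xi$ normal to $M$ such that $JT_x(M)\subset T_x(M)\oplus\mathrm{span}\{\xi_x\}$ for every $x\in M$; this $\xi$ is called the distinguished vector field and is fixed throughout. Let $\overline{\nabla}$ and $\nabla$ be the Levi-Civita connections of $\overline{M}$ and $M$, and let $D$ be the normal connection induced by $\overline{\nabla}$ in the normal bundle of $M$. The shape operator $A$ of $\xi$ is the symmetric endomorphism of $T(M)$ defined by $\overline{\nabla}_X\xi=-AX+D_X\xi$ for $X$ tangent to $M$. The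 condition $\nabla A=0$ means $(\nabla_XA)Y=\nabla_X(AY)-A(\nabla_XY)=0$ for all vector fields $X,Y$ tangent to $M$. *)

(* Defs.v *)
From HB Require Import structures.
From mathcomp Require Import all_boot all_order all_algebra.
From mathcomp Require Import all_classical all_reals all_analysis.

Set Implicit Arguments.
Unset Strict Implicit.
Unset Printing Implicit Defensive.

Import Order.TTheory GRing.Theory Num.Theory.
Import numFieldNormedType.Exports.
Local Open Scope classical_set_scope.
Local Open Scope ring_scope.

(* [U] is meant to be open. *)
Fixpoint Ck_on (R : realType) (V W : normedModType R) (k : nat)
    (U : set V) (h : V -> W) : Prop :=
  match k with
  | 0 => forall u, U u -> {for u, continuous h}
  | k'.+1 => (forall u, U u -> differentiable h u) /\
             (forall v, Ck_on k' U ('D_v h))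
  end.

Definition smooth_on (R : realType) (V W : normedModType R)
    (U : set V) (h : V -> W) : Prop := forall k, Ck_on k U h.

(* [param] inverts [coord]; it is a total function, whose values outside
   [coord @` dom] are irrelevant. *)
Record chart (R : realType) (T : topologicalType) (m : nat) := Chart {
  dom : set T;
  coord : T -> 'rV[R]_m;
  param : 'rV[R]_m -> T;
  dom_open : open dom;
  codom_open : open (coord @` dom);
  coordK : forall x, dom x -> param (coord x) = x;
  coord_continuous : forall x, dom x -> {for x, continuous coord};
  param_continuous : forall x, dom x -> {for coord x, continuous param}
}.

Record manifold (R : realType) (m : nat) := Manifold {
  points :> topologicalType;
  atlas : set (chart R points m);
  points_hausdorff : hausdorff_space points;
  points_second_countable : @second_countable points;
  atlas_cover : forall x, exists2 a, atlas a & dom a x;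
  atlas_smooth : forall a b, atlas a -> atlas b ->
    smooth_on (coord a @` (dom a `&` dom b)) (coord b \o param a)
}.

Definition chart_of (R : realType) (m : nat) (M : manifold R m) :=
  chart R M m.

Definition chart_at (R : realType) (m : nat) (M : manifold R m)
    (a : chart_of M) (x : M) : Prop := atlas a /\ dom a x.

(* Matrix of the differential of [f] at [x] in the charts [a] and [b].  As
   tangent vectors are row vectors, it acts by right multiplication; [dmap id]
   gives the changes of coordinates. *)
Definition dmap (R : realType) (m k : nat) (M : manifold R m)
    (N : manifold R k) (f : M -> N) (a : chart_of M) (b : chart_of N) (x : M)
    : 'M[R]_(m, k) :=
  'J (coord b \o f \o param a) (coord a x).

Definition smooth_map (R : realType) (m k : nat) (M : manifold R m)
    (N : manifold R k) (f : M -> N) : Prop :=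
  continuous f /\
  forall (a : chart_of M) (b : chart_of N), atlas a -> atlas b ->
    smooth_on (coord a @` (dom a `&` f @^-1` dom b)) (coord b \o f \o param a).

Definition immersion (R : realType) (m k : nat) (M : manifold R m)
    (N : manifold R k) (f : M -> N) : Prop :=
  smooth_map f /\
  forall x a b, chart_at a x -> chart_at b (f x) -> row_free (dmap f a b x).

(* A tensor field is given by its components at each point in each chart of
   the atlas, subject to the transformation law under changes of charts.  The
   matrix [A] of an endomorphism maps the row vector [v] to [v *m A], and the
   matrix [G] of a bilinear form maps [(v, w)] to [v *m G *m w^T]. *)

Definition vfield (R : realType) (m : nat) (M : manifold R m) :=
  chart_of M -> M -> 'rV[R]_m.

Definition tensor2 (R : realType) (m : nat) (M : manifold R m) :=
  chart_of M -> M -> 'M[R]_m.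

Definition is_vfield_on (R : realType) (m : nat) (M : manifold R m)
    (W : set M) (X : vfield M) : Prop :=
  (forall x a b, W x -> chart_at a x -> chart_at b x ->
     X b x = X a x *m dmap (@id M) a b x) /\
  (forall a : chart_of M, atlas a ->
     smooth_on (coord a @` (W `&` dom a)) (X a \o param a)).

Definition is_endo (R : realType) (m : nat) (M : manifold R m)
    (A : tensor2 M) : Prop :=
  (forall x a b, chart_at a x -> chart_at b x ->
     A a x *m dmap (@id M) a b x = dmap (@id M) a b x *m A b x) /\
  (forall a : chart_of M, atlas a ->
     smooth_on (coord a @` dom a) (A a \o param a)).

Definition endo_app (R : realType) (m : nat) (M : manifold R m)
    (A : tensor2 M) (X : vfield M) : vfield M :=
  fun a x => X a x *m A a x.

Definition form (R : realType) (m : nat) (G : 'M[R]_m) (v w : 'rV[R]_m) : R :=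
  (v *m G *m w^T) 0 0.

Definition is_riemannian (R : realType) (m : nat) (M : manifold R m)
    (g : tensor2 M) : Prop :=
  [/\ forall x a b, chart_at a x -> chart_at b x ->
        g a x = dmap (@id M) a b x *m g b x *m (dmap (@id M) a b x)^T,
      forall a : chart_of M, atlas a ->
        smooth_on (coord a @` dom a) (g a \o param a),
      forall x a, chart_at a x -> (g a x)^T = g a x
    & forall x a v, chart_at a x -> v != 0 -> 0 < form (g a x) v v].

(* Derivative of the components of [g] at [x] in the direction [v]. *)
Definition dmetric (R : realType) (m : nat) (M : manifold R m)
    (g : tensor2 M) (a : chart_of M) (x : M) (v : 'rV[R]_m) : 'M[R]_m :=
  'D_v (g a \o param a) (coord a x).

(* The vector with components Gamma^k_(ij) v^i w^j, where
   Gamma^k_(ij) = 1/2 g^(kl) (d_i g_(jl) + d_j g_(il) - d_l g_(ij)). *)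
Definition christoffel (R : realType) (m : nat) (M : manifold R m)
    (g : tensor2 M) (a : chart_of M) (x : M) (v w : 'rV[R]_m) : 'rV[R]_m :=
  (\row_l (2^-1 * (form (dmetric g a x v) w (delta_mx 0 l)
                 + form (dmetric g a x w) v (delta_mx 0 l)
                 - form (dmetric g a x (delta_mx 0 l)) v w)))
  *m invmx (g a x).

Definition nabla (R : realType) (m : nat) (M : manifold R m)
    (g : tensor2 M) (X Y : vfield M) : vfield M :=
  fun a x => 'D_(X a x) (Y a \o param a) (coord a x)
             + christoffel g a x (X a x) (Y a x).

(* Covariant constancy of an endomorphism field.  Vector fields are allowed to
   be defined on an arbitrary open subset only. *)
Definition parallel (R : realType) (m : nat) (M : manifold R m)
    (g A : tensor2 M) : Prop :=
  forall (W : set M) (X Y : vfield M), open W ->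
    is_vfield_on W X -> is_vfield_on W Y ->
    forall x a, W x -> chart_at a x ->
      nabla g X (endo_app A Y) a x - endo_app A (nabla g X Y) a x = 0.

Definition const_vfield (R : realType) (m : nat) (M : manifold R m)
    (v : 'rV[R]_m) : vfield M := fun _ _ => v.

(* R(u, v) w at [x] in the chart [a], evaluated on the vector fields with
   constant components in [a]; their brackets vanish, so that
   R(u, v) w = nabla_u (nabla_v w) - nabla_v (nabla_u w). *)
Definition curvature (R : realType) (m : nat) (M : manifold R m)
    (g : tensor2 M) (a : chart_of M) (x : M) (u v w : 'rV[R]_m) : 'rV[R]_m :=
  let U : vfield M := const_vfield u in
  let V : vfield M := const_vfield v in
  let Z : vfield M := const_vfield w in
  nabla g U (nabla g V Z) a x - nabla g V (nabla g U Z) a x.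

Definition sectional_curvature (R : realType) (m : nat) (M : manifold R m)
    (g : tensor2 M) (a : chart_of M) (x : M) (u v : 'rV[R]_m) : R :=
  form (g a x) (curvature g a x u v v) u
  / (form (g a x) u u * form (g a x) v v - form (g a x) u v ^+ 2).

Definition is_kaehler (R : realType) (m : nat) (N : manifold R m)
    (J g : tensor2 N) : Prop :=
  [/\ is_riemannian g,
      is_endo J,
      forall y b, chart_at b y -> J b y *m J b y = - 1%:M,
      forall y b u v, chart_at b y ->
        form (g b y) (u *m J b y) (v *m J b y) = form (g b y) u v
    & parallel g J].

Definition complex_space_form (R : realType) (m : nat) (N : manifold R m)
    (J g : tensor2 N) (c : R) : Prop :=
  is_kaehler J g /\
  forall y b u, chart_at b y -> u != 0 ->
    sectional_curvature g b y u (u *m J b y) = 4 * c.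

(* Below, the row space of [dmap f a b x] is T_x(M), seen in the ambient
   tangent space at [f x]. *)

Definition vfield_along (R : realType) (m k : nat) (M : manifold R m)
    (N : manifold R k) (f : M -> N) := chart_of N -> M -> 'rV[R]_k.

Definition is_vfield_along (R : realType) (m k : nat) (M : manifold R m)
    (N : manifold R k) (f : M -> N) (V : vfield_along f) : Prop :=
  (forall x b b', chart_at b (f x) -> chart_at b' (f x) ->
     V b' x = V b x *m dmap (@id N) b b' (f x)) /\
  (forall (a : chart_of M) (b : chart_of N), atlas a -> atlas b ->
     smooth_on (coord a @` (dom a `&` f @^-1` dom b)) (V b \o param a)).

(* The ambient covariant derivative, in the direction of the vector [v] with
   components in the chart [a] of M, of a vector field along [f]. *)
Definition nabla_along (R : realType) (m k : nat) (M : manifold R m)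
    (N : manifold R k) (f : M -> N) (gbar : tensor2 N) (V : vfield_along f)
    (a : chart_of M) (b : chart_of N) (x : M) (v : 'rV[R]_m) : 'rV[R]_k :=
  'D_v (V b \o param a) (coord a x)
  + christoffel gbar b (f x) (v *m dmap f a b x) (V b x).

Definition is_induced_metric (R : realType) (m k : nat) (M : manifold R m)
    (N : manifold R k) (f : M -> N) (gbar : tensor2 N) (g : tensor2 M)
    : Prop :=
  is_riemannian g /\
  forall x a b, chart_at a x -> chart_at b (f x) ->
    g a x = dmap f a b x *m gbar b (f x) *m (dmap f a b x)^T.

Definition is_normal_at (R : realType) (m k : nat) (M : manifold R m)
    (N : manifold R k) (f : M -> N) (gbar : tensor2 N)
    (a : chart_of M) (b : chart_of N) (x : M) (w : 'rV[R]_k) : Prop :=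
  forall v, form (gbar b (f x)) w (v *m dmap f a b x) = 0.

(* [\rank] is the real dimension of H_x(M) = J T_x(M) :&: T_x(M), that is twice
   its complex dimension. *)
Definition CR_max_dim (R : realType) (m k : nat) (M : manifold R m)
    (N : manifold R k) (f : M -> N) (J : tensor2 N) : Prop :=
  forall x a b, chart_at a x -> chart_at b (f x) ->
    (\rank (dmap f a b x *m J b (f x) :&: dmap f a b x)%MS).+1 = m.

Definition distinguished (R : realType) (m k : nat) (M : manifold R m)
    (N : manifold R k) (f : M -> N) (J gbar : tensor2 N)
    (xi : vfield_along f) : Prop :=
  is_vfield_along xi /\
  forall x a b, chart_at a x -> chart_at b (f x) ->
    [/\ form (gbar b (f x)) (xi b x) (xi b x) = 1,
        is_normal_at f gbar a b x (xi b x)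
      & (dmap f a b x *m J b (f x) <= dmap f a b x + xi b x)%MS].

(* [D] is the normal component D_v xi of the ambient derivative. *)
Definition is_shape_operator (R : realType) (m k : nat) (M : manifold R m)
    (N : manifold R k) (f : M -> N) (gbar : tensor2 N)
    (xi : vfield_along f) (A : tensor2 M) : Prop :=
  is_endo A /\
  forall x a b v, chart_at a x -> chart_at b (f x) ->
    exists2 D, is_normal_at f gbar a b x D &
      nabla_along gbar xi a b x v = - (v *m A a x *m dmap f a b x) + D.

(* Main.v *)
From HB Require Import structures.
Require Import Defs.
From mathcomp Require Import all_boot all_order all_algebra.
From mathcomp Require Import all_classical all_reals all_analysis.
From mathcomp Require Import ring lra zify.
Import Defs.
Import Order.TTheory GRing.Theory Num.Theory.
Import numFieldNormedType.Exports.
Set Implicit Arguments.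
Unset Strict Implicit.
Local Open Scope classical_set_scope.
Local Open Scope ring_scope.

(** Write [D_u xi] for the normal component of the ambient derivative of [xi]
along the tangent vector [u], so that this derivative is [- A u + D_u xi].

The vectors [D_u xi] are orthogonal to the tangent space and, [xi] being a unit
field, to [xi]; they lie in a space of dimension [p - 1].  Asking that
[D_u xi = 0] and that [J u] be tangent therefore imposes at most [p] linear
conditions on [u], and as [p < n] there is a tangent vector [u <> 0] satisfying
them ([exists_null_direction], [holomorphic_tangent]).  Put [v := J u].

Differentiate the decomposition of the derivative of [xi] once more and
antisymmetrize: [Rbar (u, v) xi] appears on one side.  Take the inner product
with the tangent vector [J xi].  The part coming from [A] is, by the formula of
Gauss, [(nabla_v A) u - (nabla_u A) v], which vanishes since [nabla A = 0].  The
part coming from [D] is found by differentiating [<D_v xi, J xi> = 0], and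
[J] being parallel it is [<D_u xi, J D_v xi> - <D_v xi, J D_u xi>], which
vanishes since [D_u xi = 0].  Hence [<Rbar (u, J u) xi, J xi> = 0] ([codazzi]).

In a space of constant holomorphic sectional curvature [4 c], on the other hand,
[<Rbar (X, J X) J Y, Y> = 2 c |X|^2 |Y|^2] when [Y] is orthogonal to [X] and
[J X] ([bisectional_curvature]).  With [X := u] and [Y := xi] this gives
[c |u|^2 = 0], so that [c = 0].

All differential geometry takes place in one chart of [M] and one of the
ambient manifold.  A connection is represented there by the matrices [C z v]
such that [nabla_v W = 'D_v W + W *m C z v]; along the immersion [phi], the
ambient connection becomes the operator [cov].  The parallelism hypotheses speak
of globally consistent smooth vector fields; they are exploited on fields with
constant components in a chart, whose smoothness in the other charts rests on
the stability of smoothness under composition ([parallel_in_chart]). *)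

(** * Functions of class C^k *)

Lemma near_open (T : topologicalType) (U : set T) (P : T -> Prop) (x : T) :
  open U -> U x -> (forall z, U z -> P z) -> \forall z \near x, P z.
Proof.
by move=> oU Ux UP; apply: filterS UP _; apply: open_nbhs_nbhs.
Qed.

Lemma differentiable_mxP (R : realType) (V : normedModType R) (m n : nat)
    (h : V -> 'M[R]_(m, n)) (x : V) :
  differentiable h x <-> forall i j, differentiable (fun z => h z i j) x.
Proof.
split=> [dh i j|dh].
  exact: (differentiable_comp dh (differentiable_coord (h x) i j)).
have -> : h = \sum_(i < m) \sum_(j < n)
    (fun z => h z i j *: (delta_mx i j : 'M[R]_(m, n))).
  apply/funext => z; rewrite fct_sumE [LHS]matrix_sum_delta.
  by apply: eq_bigr => i _; rewrite fct_sumE.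
apply: differentiable_sum => i; apply: differentiable_sum => j.
exact: differentiableZl.
Qed.

(** Differentiability is local: near [x] the two functions have the same
first-order expansion, and [diff_unique] identifies the differential. *)
Lemma near_eq_differentiable (R : realType) (V W : normedModType R)
    (f g : V -> W) (x : V) :
  (\near x, f x = g x) -> differentiable f x -> differentiable g x.
Proof.
move=> fg df; have [cdf ef] := (diff_locallyP x f).1 df.
have eg : g \o shift x = cst (g x) + 'd f x +o_ 0 id.
  apply/eqaddoP => _/posnumP[e].
  have /eqaddoP /(_ e%:num) /(_ [gt0 of e%:num]) := ef.
  have fgx : f x = g x by apply: nbhs_singleton fg.
  apply: filter_app; have := fg; rewrite (near_shift 0 x) => fg0.
  apply: filterS fg0 => h; rewrite subr0 /= => fgh.
  rewrite -![(_ + _ : _ -> _) _]/(_ + _) -![(- _ : _ -> _) _]/(- _) /=.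
  by rewrite fgh fgx.
have E := diff_unique cdf eg.
by apply/diff_locallyP; rewrite E.
Qed.

(** On an open set the values determine the derivatives, so that a function
may be replaced by any expression that agrees with it there; all closure
properties below go through this. *)
Lemma Ck_on_eq (R : realType) (V W : normedModType R) (k : nat) (U : set V)
    (f g : V -> W) :
  open U -> (forall u, U u -> f u = g u) -> Ck_on k U f -> Ck_on k U g.
Proof.
move=> oU; elim: k f g => [|k IH] f g fg /=.
  move=> cf u Uu; have := cf u Uu; rewrite /prop_for /continuous_at -fg //.
  apply: cvg_trans; apply: near_eq_cvg; apply: near_open oU Uu _ => z Uz.
  exact: fg.
move=> [df cf]; split=> [u Uu|v].
  by apply: near_eq_differentiable (df u Uu); apply: near_open oU Uu fg.
apply: IH (cf v) => u Uu; apply: near_eq_derive.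
exact: near_open oU Uu fg.
Qed.

Lemma Ck_onW (R : realType) (V W : normedModType R) (k : nat) (U : set V)
    (f : V -> W) : Ck_on k.+1 U f -> Ck_on k U f.
Proof.
elim: k f => [|k IH] f [df cf] /=.
  by move=> u Uu; apply: differentiable_continuous; exact: df.
by split=> // v; apply: IH.
Qed.

Lemma Ck_on_cst (R : realType) (V W : normedModType R) (k : nat) (U : set V)
    (c : W) : Ck_on k U (fun _ : V => c).
Proof.
elim: k c => [|k IH] c /=; first by move=> u _; apply: cvg_cst.
split=> [u _|v]; first exact: differentiable_cst.
have -> : 'D_v (fun _ : V => c) = fun _ => 0.
  by apply/funext => x; rewrite derive_cst.
exact: IH.
Qed.

Lemma Ck_onD (R : realType) (V W : normedModType R) (k : nat) (U : set V)
    (f g : V -> W) : open U ->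
  Ck_on k U f -> Ck_on k U g -> Ck_on k U (fun z => f z + g z).
Proof.
move=> oU; elim: k f g => [|k IH] f g /=.
  by move=> cf cg u Uu; apply: cvgD; [exact: cf|exact: cg].
move=> [df cf] [dg cg]; split=> [u Uu|v].
  by apply: differentiableD; [exact: df|exact: dg].
apply: Ck_on_eq (IH _ _ (cf v) (cg v)) => // u Uu.
by rewrite deriveD //; apply: diff_derivable; [exact: df|exact: dg].
Qed.

Lemma Ck_on_sum (R : realType) (V W : normedModType R) (k : nat) (U : set V)
    (I : Type) (r : seq I) (P : pred I) (f : I -> V -> W) : open U ->
  (forall i, Ck_on k U (f i)) -> Ck_on k U (fun z => \sum_(i <- r | P i) f i z).
Proof.
move=> oU cf; elim: r => [|i r IH].
  have -> : (fun z : V => \sum_(i <- [::] | P i) f i z) = fun _ => 0.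
    by apply/funext => z; rewrite big_nil.
  exact: Ck_on_cst.
have -> : (fun z : V => \sum_(j <- i :: r | P j) f j z) =
    if P i then (fun z => f i z + \sum_(j <- r | P j) f j z)
    else (fun z => \sum_(j <- r | P j) f j z).
  by apply/funext => z; rewrite big_cons; case: (P i).
by case: (P i) => //; apply: Ck_onD.
Qed.

Lemma Ck_onM (R : realType) (V : normedModType R) (k : nat) (U : set V)
    (f g : V -> R) : open U ->
  Ck_on k U f -> Ck_on k U g -> Ck_on k U (fun z => f z * g z).
Proof.
move=> oU; elim: k f g => [|k IH] f g.
  by move=> cf cg u Uu; apply: cvgM; [exact: cf|exact: cg].
move=> Cf Cg; have [df cf] := Cf; have [dg cg] := Cg.
split=> [u Uu|v].
  by apply: differentiableM; [exact: df|exact: dg].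
have H := Ck_onD oU (IH _ _ (Ck_onW Cf) (cg v)) (IH _ _ (Ck_onW Cg) (cf v)).
apply: Ck_on_eq H => // u Uu.
by rewrite deriveM //; apply: diff_derivable; [exact: df|exact: dg].
Qed.

Lemma Ck_onN (R : realType) (V : normedModType R) (k : nat) (U : set V)
    (f : V -> R) : open U -> Ck_on k U f -> Ck_on k U (fun z => - f z).
Proof.
move=> oU cf.
have c1 : Ck_on k U (fun _ : V => -1 : R) by exact: Ck_on_cst.
apply: Ck_on_eq (Ck_onM oU c1 cf) => // u _.
by rewrite mulN1r.
Qed.

Lemma Ck_onV (R : realType) (V : normedModType R) (k : nat) (U : set V)
    (f : V -> R) : open U -> (forall u, U u -> f u != 0) ->
  Ck_on k U f -> Ck_on k U (fun z => (f z)^-1).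
Proof.
move=> oU f0; elim: k => [|k IH].
  by move=> cf u Uu; apply: cvgV; [exact: f0|exact: cf].
move=> Cf; have [df cf] := Cf; have Cfi := IH (Ck_onW Cf).
split=> [u Uu|v].
  by apply: differentiableV; [exact: df|exact: f0].
have H := Ck_onN oU (Ck_onM oU (Ck_onM oU Cfi Cfi) (cf v)).
apply: Ck_on_eq H => // u Uu.
rewrite deriveV; [|exact: f0|apply: diff_derivable; exact: df].
by rewrite scaleNr -exprVn expr2.
Qed.

(** Reduces the closure properties of matrix-valued functions to those of
scalar functions. *)
Lemma Ck_on_mx (R : realType) (V : normedModType R) (m n k : nat) (U : set V)
    (f : V -> 'M[R]_(m, n)) : open U ->
  Ck_on k U f <-> forall i j, Ck_on k U (fun z => f z i j).
Proof.
move=> oU; split.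
  elim: k f => [|k IH] f.
    move=> cf i j u Uu; apply: (@continuous_comp _ _ _ f (fun M => M i j)).
      exact: cf.
    exact: matrix_normedtype.coord_continuous.
  move=> [df cf] i j; split=> [u Uu|v].
    by apply: (differentiable_mxP _ _).1; exact: df.
  apply: Ck_on_eq (IH _ (cf v) i j) => // u Uu.
  by rewrite derive_mx ?mxE//; apply: diff_derivable; exact: df.
elim: k f => [|k IH] f cf.
  have -> : f = (fun z => \sum_(i < m) \sum_(j < n)
      (f z i j *: (delta_mx i j : 'M[R]_(m, n)))).
    by apply/funext => z; rewrite [LHS]matrix_sum_delta.
  apply: Ck_on_sum => // i; apply: Ck_on_sum => // j u Uu.
  by apply: cvgZ; [exact: cf|exact: cvg_cst].
have df u : U u -> differentiable f u.
  by move=> Uu; apply/differentiable_mxP => i j; exact: (cf i j).1.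
split=> // v; apply: IH => i j.
apply: Ck_on_eq ((cf i j).2 v) => // u Uu.
by rewrite derive_mx ?mxE//; apply: diff_derivable; exact: df.
Qed.

(** * Symmetry of second derivatives *)

Lemma derive_comp (R : realType) (U V W : normedModType R) (s : U -> V)
    (f : V -> W) (x v : U) :
  differentiable s x -> differentiable f (s x) ->
  'D_v (f \o s) x = 'D_('D_v s x) f (s x).
Proof.
move=> ds df; rewrite !deriveE //; last exact: differentiable_comp.
by rewrite diff_comp.
Qed.

Lemma mvt_line (R : realType) (V : normedModType R) (f : V -> R) (y u : V)
    (h : R) : 0 < h ->
  (forall s, 0 <= s <= h -> differentiable f (y + s *: u)) ->
  exists2 s, 0 <= s <= h & f (y + h *: u) - f y = h * 'D_u f (y + s *: u).
Proof.
move=> h0 df.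
pose line := fun s : R => y + s *: u.
have diffZ s : differentiable (fun k : R => k *: u) s.
  by apply: (@differentiableZl _ _ _ (fun k : R => k)).
have dline s : is_derive s (1 : R) line u.
  apply: DeriveDef.
    by apply: derivableD; apply: diff_derivable.
  rewrite deriveD; [|exact: diff_derivable..].
  rewrite derive_cst add0r deriveE // (@diffZl _ _ _ (fun k : R => k)) //.
  by rewrite -deriveE // derive_id scale1r.
have diffline s : differentiable line s.
  apply: differentiableD; first exact: differentiable_cst.
  exact: diffZ.
have dfl s : 0 <= s <= h -> is_derive s (1 : R) (f \o line) ('D_u f (line s)).
  move=> sh; apply: DeriveDef.
    by apply: diff_derivable; apply: differentiable_comp => //; exact: df.
  by rewrite derive_comp //; [rewrite derive_val|exact: df].
have [|c|c ch] := @MVT R (f \o line) (fun s => 'D_u f (line s)) 0 h h0.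
- move=> s; rewrite in_itv /= => /andP[s0 sh]; apply: dfl.
  by rewrite !ltW.
- apply: continuous_in_subspaceT => s; rewrite inE /= in_itv /= => sh.
  apply: differentiable_continuous; apply: differentiable_comp => //.
  exact: df.
rewrite /line /= scale0r addr0 subr0 mulrC => ->.
exists c => //; move: ch; rewrite in_itv /= => /andP[s0 sh].
by rewrite !ltW.
Qed.

(** Turns approximate equality of two mixed second derivatives, at two
different points close to [x], into equality at [x]. *)
Lemma eq_of_near_values (R : realType) (V : normedModType R) (P Q : V -> R)
    (x : V) : {for x, continuous P} -> {for x, continuous Q} ->
  (forall r, 0 < r -> exists y z, [/\ ball x r y, ball x r z & P y = Q z]) ->
  P x = Q x.
Proof.
move=> cP cQ PQ; apply/eqP; rewrite -subr_eq0 -normr_le0.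
apply/ler_addgt0Pr => e e0; rewrite add0r.
have e2 : 0 < e / 2 by rewrite divr_gt0.
have [r1 /= r10 Pr] := (nbhs_ballP _ _).1 ((cvgrPdist_lt _ _).1 cP _ e2).
have [r2 /= r20 Qr] := (nbhs_ballP _ _).1 ((cvgrPdist_lt _ _).1 cQ _ e2).
have [|y [z [yb zb E]]] := PQ (Num.min r1 r2); first by rewrite lt_min r10.
have {}yb : ball x r1 y by apply: le_ball yb; rewrite ge_min lexx.
have {}zb : ball x r2 z by apply: le_ball zb; rewrite ge_min lexx orbT.
rewrite -(subrKA (P y)) (le_trans (ler_normD _ _)) // (splitr e) lerD //.
  by apply: ltW; exact: Pr.
by rewrite E distrC; apply: ltW; exact: Qr.
Qed.

(** Two applications of the mean value theorem: the first is to [fun y => f (y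
+ h *: v) - f y] along [u], the second to ['D_u f] along [v]. *)
Lemma mixed_difference (R : realType) (V : normedModType R) (U : set V)
    (f : V -> R) (x u v : V) (h : R) : 0 < h -> Ck_on 2 U f ->
  (forall s t, 0 <= s <= h -> 0 <= t <= h -> U (x + s *: u + t *: v)) ->
  exists s t, [/\ 0 <= s <= h, 0 <= t <= h &
    f (x + h *: u + h *: v) - f (x + h *: u) - f (x + h *: v) + f x
    = h * (h * 'D_v ('D_u f) (x + s *: u + t *: v))].
Proof.
move=> h0 [df d2f] inU.
have ddf y : U y -> differentiable ('D_u f) y by exact: (d2f u).1.
have h00 : 0 <= (0 : R) <= h by apply/andP; split => //; exact: ltW.
pose F y := f (y + h *: v) - f y.
have dtrans y : differentiable (fun y => y + h *: v) y.
  exact: differentiableD.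
have dsh y : U (y + h *: v) -> differentiable (fun y => f (y + h *: v)) y.
  by move=> Uy; apply: differentiable_comp (dtrans y) _; exact: df.
have inU0 s : 0 <= s <= h -> U (x + s *: u).
  by move=> sh; have := inU s 0 sh h00; rewrite scale0r addr0.
have h01 : 0 <= h <= h by apply/andP; split => //; exact: ltW.
have dF s : 0 <= s <= h -> differentiable F (x + s *: u).
  move=> sh; apply: differentiableB; first by apply: dsh; exact: inU.
  by apply: df; exact: inU0.
have [s sh Es] := mvt_line h0 dF.
have [|t th Et] := @mvt_line _ _ ('D_u f) (x + s *: u) v h h0.
  by move=> t th; apply: ddf; exact: inU.
exists s, t; split=> //; rewrite -Et.
have -> : 'D_u f (x + s *: u + h *: v) - 'D_u f (x + s *: u)
    = 'D_u F (x + s *: u).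
  rewrite /F deriveB; last 2 first.
  - by apply: diff_derivable; apply: dsh; exact: inU.
  - by apply: diff_derivable; apply: df; exact: inU0.
  congr (_ - _); apply/esym.
  rewrite (@derive_comp _ _ _ _ (fun y => y + h *: v) f).
  - by rewrite deriveD // derive_id derive_cst addr0.
  - exact: dtrans.
  - by apply: df; exact: inU.
by rewrite -Es /F opprB [X in _ = _ + X]addrC addrA.
Qed.

(** The mixed second difference is symmetric in [u] and [v], whereas
[mixed_difference] expresses it through either of the two mixed derivatives.
*)
Lemma schwarz (R : realType) (V : normedModType R) (U : set V) (f : V -> R)
    (u v x : V) : open U -> U x -> Ck_on 2 U f ->
  'D_u ('D_v f) x = 'D_v ('D_u f) x.
Proof.
move=> oU Ux C2f.
apply: (@eq_of_near_values _ _ ('D_u ('D_v f)) ('D_v ('D_u f))).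
- exact: (C2f.2 v).2.
- exact: (C2f.2 u).2.
move=> r r0.
have [r1 /= r10 rU] := (nbhs_ballP _ _).1 (open_nbhs_nbhs (conj oU Ux)).
pose r' := Num.min r1 r.
have r'0 : 0 < r' by rewrite lt_min r10.
(* small enough for the parallelogram spanned at x by h u and h v to stay in
the ball of radius r'; the summand 1 covers the case u = v = 0 *)
pose h := r' / (2 * (`|u| + `|v| + 1)).
have N0 : 0 < `|u| + `|v| + 1 by rewrite ltr_wpDl // addr_ge0.
have h0 : 0 < h by rewrite divr_gt0 // mulr_gt0.
have inr s t : 0 <= s <= h -> 0 <= t <= h -> ball x r' (x + s *: u + t *: v).
  move=> /andP[s0 sh] /andP[t0 th].
  rewrite -ball_normE /ball_ /= -addrA opprD addNKr normrN.
  apply: le_lt_trans (ler_normD _ _) _; rewrite !normrZ !ger0_norm //.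
  apply: (@le_lt_trans _ _ (h * (`|u| + `|v| + 1))).
    rewrite !mulrDr -addrA lerD ?ler_wpM2r //.
    by rewrite -[leLHS]addr0 lerD ?ler_wpM2r ?mulr_ge0 // ltW.
  rewrite /h invfM mulrA -mulrA mulVf ?gt_eqF // mulr1.
  by rewrite ltr_pdivrMr // mulr_natr mulr2n ltrDl.
have inU s t : 0 <= s <= h -> 0 <= t <= h -> U (x + s *: u + t *: v).
  move=> sh th; apply: rU; apply: le_ball (inr _ _ sh th).
  by rewrite ge_min lexx.
have inb s t : 0 <= s <= h -> 0 <= t <= h -> ball x r (x + s *: u + t *: v).
  move=> sh th; apply: le_ball (inr _ _ sh th).
  by rewrite ge_min lexx orbT.
have [s [t [sh th E1]]] := mixed_difference h0 C2f inU.
have [|t' [s' [th' sh' E2]]] := @mixed_difference _ _ U f x v u h h0 C2f.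
  by move=> t' s' th' sh'; rewrite addrAC; exact: inU.
exists (x + t' *: v + s' *: u), (x + s *: u + t *: v).
split; [by rewrite addrAC; exact: inb|exact: inb|].
apply: (mulfI (lt0r_neq0 h0)); apply: (mulfI (lt0r_neq0 h0)).
apply: etrans (esym E2) _; apply: etrans _ E1.
by rewrite (addrAC x (h *: v)) [X in X + _ = _]addrAC.
Qed.

(** * Smooth matrix-valued functions *)

Lemma derive_coord (R : realType) (V : normedModType R) (m n : nat)
    (f : V -> 'M[R]_(m, n)) (x v : V) (i : 'I_m) (j : 'I_n) :
  differentiable f x -> ('D_v f x) i j = 'D_v (fun z => f z i j) x.
Proof.
by move=> df; rewrite derive_mx ?mxE //; exact: diff_derivable.
Qed.

Lemma derive_row_sum (R : realType) (m : nat) (W : normedModType R)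
    (f : 'rV[R]_m -> W) (x v : 'rV[R]_m) : differentiable f x ->
  'D_v f x = \sum_i v 0 i *: 'D_(delta_mx 0 i) f x.
Proof.
move=> df; rewrite deriveE // {1}(row_sum_delta v) linear_sum.
by apply: eq_bigr => i _; rewrite linearZ deriveE.
Qed.

(** By the chain rule, ['D_v (f \o s)] is a sum of products of derivatives of
[s] with compositions of [s] and the partial derivatives of [f], to which the
induction hypothesis applies. *)
Lemma Ck_on_comp_scalar (R : realType) (V : normedModType R) (m k : nat)
    (U : set V) (U' : set 'rV[R]_m) (s : V -> 'rV[R]_m) (f : 'rV[R]_m -> R) :
  open U -> (forall u, U u -> U' (s u)) ->
  Ck_on k U s -> Ck_on k U' f -> Ck_on k U (f \o s).
Proof.
move=> oU sU; elim: k f => [|k IH] f.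
  move=> cs cf u Uu; apply: continuous_comp; first exact: cs.
  by apply: cf; exact: sU.
move=> Cs Cf; have [ds cs] := Cs; have [df cf] := Cf.
split=> [u Uu|v].
  by apply: differentiable_comp; [exact: ds|apply: df; exact: sU].
have H : Ck_on k U
    (fun z => \sum_(i < m) ('D_v s z) 0 i * ('D_(delta_mx 0 i) f \o s) z).
  apply: Ck_on_sum => // i; apply: Ck_onM => //.
    by apply: (Ck_on_mx _ _ oU).1; exact: cs.
  by apply: IH; [exact: Ck_onW|exact: cf].
apply: Ck_on_eq H => // u Uu.
have dsu := ds u Uu; have dfu := df _ (sU u Uu).
by rewrite [RHS]derive_comp // [RHS]derive_row_sum.
Qed.

Lemma smooth_on_eq (R : realType) (V W : normedModType R) (U : set V)
    (f g : V -> W) :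
  open U -> (forall u, U u -> f u = g u) -> smooth_on U f -> smooth_on U g.
Proof. by move=> oU fg cf k; apply: Ck_on_eq (cf k). Qed.

Lemma smooth_onS (R : realType) (V W : normedModType R) (U U' : set V)
    (f : V -> W) : U' `<=` U -> smooth_on U f -> smooth_on U' f.
Proof.
move=> sU cf k; elim: k f {cf}(cf k) => [|k IH] f /=.
  by move=> cf u /sU; exact: cf.
by move=> [df cf]; split=> [u /sU|v]; [exact: df|exact: IH].
Qed.

Lemma smooth_on_differentiable (R : realType) (V W : normedModType R)
    (U : set V) (f : V -> W) (x : V) :
  smooth_on U f -> U x -> differentiable f x.
Proof. by move=> cf; exact: (cf 1).1. Qed.

Lemma smooth_on_derivable (R : realType) (V W : normedModType R)
    (U : set V) (f : V -> W) (x v : V) :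
  smooth_on U f -> U x -> derivable f x v.
Proof.
by move=> cf Ux; apply: diff_derivable; exact: smooth_on_differentiable cf Ux.
Qed.

Lemma smooth_on_derive (R : realType) (V W : normedModType R)
    (U : set V) (f : V -> W) (v : V) : smooth_on U f -> smooth_on U ('D_v f).
Proof. by move=> cf k; exact: (cf k.+1).2. Qed.

Lemma smooth_on_cst (R : realType) (V W : normedModType R) (U : set V)
    (c : W) : smooth_on U (fun _ : V => c).
Proof. by move=> k; exact: Ck_on_cst. Qed.

Lemma smooth_onD (R : realType) (V W : normedModType R) (U : set V)
    (f g : V -> W) : open U ->
  smooth_on U f -> smooth_on U g -> smooth_on U (fun z => f z + g z).
Proof. by move=> oU cf cg k; exact: Ck_onD. Qed.

Lemma smooth_on_mx (R : realType) (V : normedModType R) (m n : nat)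
    (U : set V) (f : V -> 'M[R]_(m, n)) : open U ->
  smooth_on U f <-> forall i j, smooth_on U (fun z => f z i j).
Proof.
move=> oU; split=> [cf i j k|cf k]; first by apply: (Ck_on_mx _ _ oU).1.
by apply/Ck_on_mx => // i j; exact: cf.
Qed.

Lemma smooth_on_comp (R : realType) (V : normedModType R) (m p q : nat)
    (U : set V) (U' : set 'rV[R]_m) (s : V -> 'rV[R]_m)
    (f : 'rV[R]_m -> 'M[R]_(p, q)) :
  open U -> open U' -> (forall u, U u -> U' (s u)) ->
  smooth_on U s -> smooth_on U' f -> smooth_on U (fun z => f (s z)).
Proof.
move=> oU oU' sU cs /(smooth_on_mx _ oU') cf.
apply/(smooth_on_mx _ oU) => i j k.
apply: (@Ck_on_comp_scalar _ _ _ _ _ U' s (fun z => f z i j)) => //.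
exact: cf.
Qed.

Lemma smooth_on_sum (R : realType) (V W : normedModType R) (U : set V)
    (I : Type) (r : seq I) (P : pred I) (f : I -> V -> W) : open U ->
  (forall i, smooth_on U (f i)) ->
  smooth_on U (fun z => \sum_(i <- r | P i) f i z).
Proof. by move=> oU cf k; apply: Ck_on_sum => // i; exact: cf. Qed.

Lemma smooth_onM (R : realType) (V : normedModType R) (U : set V)
    (f g : V -> R) : open U ->
  smooth_on U f -> smooth_on U g -> smooth_on U (fun z => f z * g z).
Proof. by move=> oU cf cg k; exact: Ck_onM. Qed.

Lemma smooth_on_prod (R : realType) (V : normedModType R) (U : set V)
    (I : Type) (r : seq I) (P : pred I) (f : I -> V -> R) : open U ->
  (forall i, smooth_on U (f i)) ->
  smooth_on U (fun z => \prod_(i <- r | P i) f i z).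
Proof.
move=> oU cf; elim: r => [|i r IH].
  have -> : (fun z : V => \prod_(i <- [::] | P i) f i z) = fun _ => 1.
    by apply/funext => z; rewrite big_nil.
  exact: smooth_on_cst.
have -> : (fun z : V => \prod_(j <- i :: r | P j) f j z) =
    if P i then (fun z => f i z * \prod_(j <- r | P j) f j z)
    else (fun z => \prod_(j <- r | P j) f j z).
  by apply/funext => z; rewrite big_cons; case: (P i).
by case: (P i) => //; apply: smooth_onM.
Qed.

Lemma smooth_on_mulmx (R : realType) (V : normedModType R) (m n p : nat)
    (U : set V) (f : V -> 'M[R]_(m, n)) (g : V -> 'M[R]_(n, p)) : open U ->
  smooth_on U f -> smooth_on U g -> smooth_on U (fun z => f z *m g z).
Proof.
move=> oU /(smooth_on_mx _ oU) cf /(smooth_on_mx _ oU) cg.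
apply/(smooth_on_mx _ oU) => i j.
have H : smooth_on U (fun z => \sum_k f z i k * g z k j).
  by apply: smooth_on_sum => // k; apply: smooth_onM.
by apply: smooth_on_eq H => // z _; rewrite mxE.
Qed.

Lemma smooth_onZ (R : realType) (V : normedModType R) (m n : nat)
    (U : set V) (f : V -> R) (g : V -> 'M[R]_(m, n)) : open U ->
  smooth_on U f -> smooth_on U g -> smooth_on U (fun z => f z *: g z).
Proof.
move=> oU cf /(smooth_on_mx _ oU) cg; apply/(smooth_on_mx _ oU) => i j.
apply: (smooth_on_eq oU _ (smooth_onM oU cf (cg i j))) => z _.
by rewrite mxE.
Qed.

Lemma smooth_on_trmx (R : realType) (V : normedModType R) (m n : nat)
    (U : set V) (f : V -> 'M[R]_(m, n)) : open U ->
  smooth_on U f -> smooth_on U (fun z => (f z)^T).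
Proof.
move=> oU /(smooth_on_mx _ oU) cf; apply/(smooth_on_mx _ oU) => i j.
by apply: (smooth_on_eq oU _ (cf j i)) => z _; rewrite mxE.
Qed.

Lemma smooth_on_det (R : realType) (V : normedModType R) (n : nat)
    (U : set V) (f : V -> 'M[R]_n) : open U ->
  smooth_on U f -> smooth_on U (fun z => \det (f z)).
Proof.
move=> oU /(smooth_on_mx _ oU) cf; rewrite /determinant.
apply: smooth_on_sum => // s; apply: smooth_onM => //.
  exact: smooth_on_cst.
exact: smooth_on_prod.
Qed.

(** Cramer's formula: the inverse is a rational function of the entries. *)
Lemma smooth_on_invmx (R : realType) (V : normedModType R) (n : nat)
    (U : set V) (f : V -> 'M[R]_n) : open U ->
  (forall u, U u -> f u \in unitmx) ->
  smooth_on U f -> smooth_on U (fun z => invmx (f z)).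
Proof.
move=> oU fU cf.
have cdet : smooth_on U (fun z => (\det (f z))^-1).
  move=> k; apply: Ck_onV => //; last exact: smooth_on_det.
  by move=> u Uu; have := fU u Uu; rewrite unitmxE unitfE.
have cadj : smooth_on U (fun z => \adj (f z)).
  apply/smooth_on_mx => // i j.
  have H : smooth_on U (fun z => cofactor (f z) j i).
    apply: smooth_onM => //; first exact: smooth_on_cst.
    apply: smooth_on_det => //; apply/smooth_on_mx => // i' j'.
    have sij := (smooth_on_mx f oU).1 cf (lift j i') (lift i j').
    apply: (smooth_on_eq oU _ sij).
    by move=> u _; rewrite !mxE.
  by apply: smooth_on_eq H => // u _; rewrite mxE.
apply: (smooth_on_eq oU _ (smooth_onZ oU cdet cadj)) => u Uu.
by rewrite /invmx fU.
Qed.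

Lemma derive_mulmx (R : realType) (V : normedModType R) (m n p : nat)
    (f : V -> 'M[R]_(m, n)) (g : V -> 'M[R]_(n, p)) (x v : V) :
  differentiable f x -> differentiable g x ->
  'D_v (fun z => f z *m g z) x = 'D_v f x *m g x + f x *m 'D_v g x.
Proof.
move=> df dg.
have df' := (differentiable_mxP f x).1 df.
have dg' := (differentiable_mxP g x).1 dg.
have dfg i j : (fun z => (f z *m g z) i j)
    = \sum_k (fun z => f z i k) * (fun z => g z k j).
  by apply/funext => z; rewrite mxE fct_sumE.
apply/matrixP => i j; rewrite derive_coord; last first.
  apply/differentiable_mxP => k l; rewrite dfg.
  by apply: differentiable_sum => r; exact: differentiableM.
rewrite dfg derive_sum; last first.
  by move=> k; apply: diff_derivable; exact: differentiableM.
rewrite !mxE -big_split; apply: eq_bigr => k _ /=.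
rewrite deriveM; [|exact: diff_derivable..].
rewrite (derive_coord _ _ _ df) (derive_coord _ _ _ dg) addrC.
by congr (_ + _); exact: mulrC.
Qed.

Lemma derive_trmx (R : realType) (V : normedModType R) (m n : nat)
    (f : V -> 'M[R]_(m, n)) (x v : V) : differentiable f x ->
  'D_v (fun z => (f z)^T) x = ('D_v f x)^T.
Proof.
move=> df; have df' := (differentiable_mxP f x).1 df.
have E i j : (fun z => (f z)^T i j) = (fun z => f z j i).
  by apply/funext => z; rewrite mxE.
have dT : differentiable (fun z => (f z)^T) x.
  by apply/differentiable_mxP => k l; rewrite E.
by apply/matrixP => i j; rewrite (derive_coord _ _ _ dT) E mxE derive_coord.
Qed.

Lemma schwarz_mx (R : realType) (V : normedModType R) (m n : nat) (U : set V)
    (f : V -> 'M[R]_(m, n)) (u v x : V) :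
  open U -> U x -> smooth_on U f -> 'D_u ('D_v f) x = 'D_v ('D_u f) x.
Proof.
move=> oU Ux cf; apply/matrixP => i j.
have sym w1 w2 : ('D_w1 ('D_w2 f) x) i j
    = 'D_w1 ('D_w2 (fun z => f z i j)) x.
  rewrite derive_coord.
    apply: near_eq_derive; apply: near_open oU Ux _ => z Uz.
    by apply: derive_coord; apply: smooth_on_differentiable cf Uz.
  by apply: smooth_on_differentiable (smooth_on_derive w2 cf) Ux.
apply: etrans (sym _ _) _; apply: etrans _ (esym (sym _ _)).
apply: (@schwarz _ _ U (fun z => f z i j)) => //.
exact: ((smooth_on_mx f oU).1 cf i j).
Qed.

(** * Levi-Civita connection in coordinates *)

(** The Christoffel symbols of the first kind of a metric whose derivative in
the direction [u] is [D u].  Keeping [D] abstract separates the algebra of the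
Koszul formula from the calculus. *)
Definition christoffel1 (R : realType) (m : nat) (D : 'rV[R]_m -> 'M[R]_m)
    (v : 'rV[R]_m) : 'M[R]_m :=
  \matrix_(i, l) (2^-1 * ((D v) i l
    + (v *m D (delta_mx 0 i)) 0 l - (v *m D (delta_mx 0 l)) 0 i)).

Lemma form_delta (R : realType) (m : nat) (B : 'M[R]_m) (v : 'rV[R]_m)
    (l : 'I_m) : form B v (delta_mx 0 l) = (v *m B) 0 l.
Proof. by rewrite /form trmx_delta -colE mxE. Qed.

Lemma formE (R : realType) (m : nat) (B : 'M[R]_m) (v w : 'rV[R]_m) :
  form B v w = \sum_i (v *m B) 0 i * w 0 i.
Proof. by rewrite /form mxE; apply: eq_bigr => i _; rewrite [w^T _ _]mxE. Qed.

Lemma form_sym (R : realType) (m : nat) (B : 'M[R]_m) (v w : 'rV[R]_m) :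
  B^T = B -> form B v w = form B w v.
Proof.
move=> sB; rewrite /form -[v in LHS]trmxK -[B in LHS]sB -mulmxA.
by rewrite -!trmx_mul mxE.
Qed.

Lemma christoffel1E (R : realType) (m : nat) (D : 'rV[R]_m -> 'M[R]_m)
    (v w : 'rV[R]_m) : (forall u, D u = \sum_i u 0 i *: D (delta_mx 0 i)) ->
  \row_l (2^-1 * (form (D v) w (delta_mx 0 l)
     + form (D w) v (delta_mx 0 l) - form (D (delta_mx 0 l)) v w))
  = w *m christoffel1 D v.
Proof.
move=> sumD; apply/rowP => l; rewrite !mxE !form_delta formE.
rewrite (sumD w) mulmx_sumr summxE.
rewrite [(w *m _) 0 l]mxE -big_split -sumrB mulr_sumr.
apply: eq_bigr => i _; rewrite -scalemxAr mxE /= [christoffel1 _ _ _ _]mxE.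
by ring.
Qed.

Lemma christoffel1_compat (R : realType) (m : nat) (D : 'rV[R]_m -> 'M[R]_m)
    (v : 'rV[R]_m) : (D v)^T = D v ->
  christoffel1 D v + (christoffel1 D v)^T = D v.
Proof.
move=> sD; apply/matrixP => i l.
rewrite [LHS]mxE [X in _ + X]mxE ![christoffel1 _ _ _ _]mxE.
have -> : (D v) l i = (D v) i l by rewrite -{1}sD mxE.
by field.
Qed.

Lemma christoffel1_torsion (R : realType) (m : nat) (D : 'rV[R]_m -> 'M[R]_m)
    (v w : 'rV[R]_m) : (forall u, D u = \sum_i u 0 i *: D (delta_mx 0 i)) ->
  (forall u, (D u)^T = D u) ->
  w *m christoffel1 D v = v *m christoffel1 D w.
Proof.
move=> sumD sD; rewrite -!christoffel1E //; apply/rowP => l; rewrite !mxE.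
by rewrite [form (D v) _ _ + _]addrC (form_sym v w (sD _)).
Qed.

(** The uniqueness half of the fundamental theorem of Riemannian geometry,
with the second index lowered: a torsion-free [S] compatible with the metric
is given by the Koszul formula. *)
Lemma levi_civita_unique (R : realType) (m : nat) (D S : 'rV[R]_m -> 'M[R]_m) :
  (forall u, D u = S u + (S u)^T) ->
  (forall u v, u *m S v = v *m S u) ->
  forall v, christoffel1 D v = S v.
Proof.
move=> DS torsion v; apply/matrixP => i l; rewrite mxE !DS !mulmxDr.
have rowS j j' : (v *m S (delta_mx 0 j)) 0 j' = S v j j'.
  by rewrite torsion -rowE mxE.
have colS : (v *m (S (delta_mx 0 i))^T) 0 l = (v *m (S (delta_mx 0 l))^T) 0 i.
  have E j j' : (v *m (S (delta_mx 0 j))^T) 0 j'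
      = form (S (delta_mx 0 j)) (delta_mx 0 j') v.
    by rewrite /form -mulmxA -rowE -[_ *m v^T]trmxK trmx_mul trmxK !mxE.
  by rewrite !E /form torsion.
have addE p q (B C : 'M[R]_(p, q)) a b : (B + C) a b = B a b + C a b.
  by rewrite mxE.
rewrite !addE !rowS colS [(S v)^T _ _]mxE.
by field.
Qed.

Lemma christoffel1_linear (R : realType) (m : nat) (D : 'rV[R]_m -> 'M[R]_m) :
  linear D -> linear (christoffel1 D).
Proof.
move=> lD a u v; apply/matrixP => i l.
have linE p q (B C : 'M[R]_(p, q)) j k : (a *: B + C) j k = a * B j k + C j k.
  by rewrite !mxE.
rewrite linE ![christoffel1 _ _ _ _]mxE lD !mulmxDl -!scalemxAl !linE.
by ring.
Qed.

(** The matrix of the Levi-Civita connection of the metric [G]: [nabla_v W] is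
['D_v W + W *m conn G z v]. *)
Definition conn (R : realType) (m : nat) (G : 'rV[R]_m -> 'M[R]_m)
    (z v : 'rV[R]_m) : 'M[R]_m :=
  christoffel1 (fun u => 'D_u G z) v *m invmx (G z).

Lemma derive_sym (R : realType) (m k : nat) (U : set 'rV[R]_m)
    (G : 'rV[R]_m -> 'M[R]_k) (z v : 'rV[R]_m) :
  open U -> U z -> smooth_on U G -> (forall y, U y -> (G y)^T = G y) ->
  ('D_v G z)^T = 'D_v G z.
Proof.
move=> oU Uz cG sG; rewrite -derive_trmx; last first.
  exact: smooth_on_differentiable cG Uz.
by apply: near_eq_derive; apply: (near_open oU Uz sG).
Qed.

Lemma derive_linear (R : realType) (V W : normedModType R) (f : V -> W)
    (x : V) : differentiable f x -> linear (fun v => 'D_v f x).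
Proof. by move=> df a u v; rewrite !deriveE // linearP. Qed.

Lemma conn_linear (R : realType) (m : nat) (G : 'rV[R]_m -> 'M[R]_m)
    (z : 'rV[R]_m) : differentiable G z -> linear (conn G z).
Proof.
move=> dG a u v; rewrite /conn scalemxAl -mulmxDl; congr (_ *m _).
exact: christoffel1_linear (derive_linear dG) _ _ _.
Qed.

Lemma conn_compat (R : realType) (m : nat) (G : 'rV[R]_m -> 'M[R]_m)
    (z v : 'rV[R]_m) : G z \in unitmx -> (G z)^T = G z ->
  ('D_v G z)^T = 'D_v G z ->
  'D_v G z = conn G z v *m G z + G z *m (conn G z v)^T.
Proof.
move=> uG sG sDG; rewrite -[G z in X in _ + X]sG -trmx_mul /conn mulmxKV //.
by rewrite (@christoffel1_compat _ _ (fun u => 'D_u G z)).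
Qed.

Lemma conn_torsion (R : realType) (m : nat) (G : 'rV[R]_m -> 'M[R]_m)
    (z v w : 'rV[R]_m) : differentiable G z ->
  (forall u, ('D_u G z)^T = 'D_u G z) ->
  w *m conn G z v = v *m conn G z w.
Proof.
move=> dG sG; rewrite /conn !mulmxA christoffel1_torsion // => u.
exact: derive_row_sum.
Qed.

Lemma smooth_on_conn (R : realType) (m : nat) (U : set 'rV[R]_m)
    (G : 'rV[R]_m -> 'M[R]_m) (v : 'rV[R]_m) : open U ->
  (forall z, U z -> G z \in unitmx) -> smooth_on U G ->
  smooth_on U (fun z => conn G z v).
Proof.
move=> oU uG cG; apply: smooth_on_mulmx => //; last exact: smooth_on_invmx.
have cE w i j : smooth_on U (fun z => ('D_w G z) i j).
  by apply: ((smooth_on_mx ('D_w G) oU).1); exact: smooth_on_derive.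
have cR w i : smooth_on U (fun z => (v *m 'D_w G z) 0 i).
  apply: ((smooth_on_mx (fun z => v *m 'D_w G z) oU).1).
  apply: smooth_on_mulmx => //; first exact: smooth_on_cst.
  exact: smooth_on_derive.
apply/smooth_on_mx => // i l.
have H : smooth_on U (fun z => 2^-1 * (('D_v G z) i l
    + (v *m 'D_(delta_mx 0 i) G z) 0 l
    + -1 * (v *m 'D_(delta_mx 0 l) G z) 0 i)).
  apply: smooth_onM => //; first exact: smooth_on_cst.
  apply: smooth_onD => //; last first.
    by apply: smooth_onM => //; exact: smooth_on_cst.
  by apply: smooth_onD.
apply: (smooth_on_eq oU _ H) => z _.
by rewrite [christoffel1 _ _ _ _]mxE [X in _ * (_ + X)]mulN1r.
Qed.

(** * Bisectional curvature *)

(** Sum the Bianchi identities of the four cyclic shifts of the arguments; the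
skew-symmetries cancel all but the two wanted terms. *)
Lemma curvature_pair_symmetry (R : realFieldType) (V : zmodType)
    (r : V -> V -> V -> V -> R) :
  (forall a b c d, r a b c d = - r b a c d) ->
  (forall a b c d, r a b c d = - r a b d c) ->
  (forall a b c d, r a b c d + r b c a d + r c a b d = 0) ->
  forall a b c d, r a b c d = r c d a b.
Proof.
move=> skew1 skew2 bianchi a b c d.
have h1 := bianchi a b c d; have h2 := bianchi b c d a.
have h3 := bianchi c d a b; have h4 := bianchi d a b c.
have e1 := skew2 b c d a; have e2 := skew1 c d b a; have e3 := skew2 d c b a.
have e4 := skew1 b d c a; have e5 := skew2 d b c a. 
have f1 := skew2 c d a b; have f2 := skew2 d a c b; have f3 := skew1 c a b d.
have f4 := skew2 c a d b.
have g1 := skew2 d a b c; have g2 := skew2 a b c d; have g3 := skew1 d b a c.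
have g4 := skew1 d b c a; have g5 := skew2 b d a c.
have k1 := skew1 a c b d; have k2 := skew2 a c b d; have k3 := skew2 d b a c.
have k4 := skew2 b d c a; have k5 := skew1 a c d b.
lra.
Qed.

(** Adding the hypothesis at [X + Y] and [X - Y] isolates the part of degree
two in each of [X] and [Y]; by the symmetries of [r] it is [2 * (K + 2 * b)],
with [K := r X (J X) (J Y) Y] and [b := r X (J Y) (J Y) X].  Hence [K + 2 * b]
equals [4 * c * q X * q Y].  Replacing [Y] by [J Y] leaves [K] unchanged and
turns [b] into [a := r X Y Y X], so that [K + 2 * a] has the same value.  As
[K] is [a + b] by the Bianchi identity, it equals [2 * c * q X * q Y].  The
hypotheses on [q] express the orthogonality of [X] to [Y] and [J Y]. *)
Lemma bisectional_curvature (R : realFieldType) (V : zmodType) (J : V -> V)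
    (r : V -> V -> V -> V -> R) (q : V -> R) (c : R) :
  (forall x, J (J x) = - x) -> {morph J : x y / x + y} ->
  (forall a a' b c d, r (a + a') b c d = r a b c d + r a' b c d) ->
  (forall a b c c' d, r a b (c + c') d = r a b c d + r a b c' d) ->
  (forall a b c d, r a b c d = - r b a c d) ->
  (forall a b c d, r a b c d = - r a b d c) ->
  (forall a b c d, r a b c d + r b c a d + r c a b d = 0) ->
  (forall a b c d, r a b (J c) (J d) = r a b c d) ->
  (forall x, r x (J x) (J x) x = 4 * c * q x ^+ 2) ->
  (forall x, q (J x) = q x) ->
  forall X Y, q (X + Y) = q X + q Y -> q (X - Y) = q X + q Y ->
    q (X + J Y) = q X + q Y -> q (X - J Y) = q X + q Y ->
  r X (J X) (J Y) Y = 2 * c * q X * q Y.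
Proof.
move=> JJ JD rD1 rD3 skew1 skew2 bianchi rJ hol qJ.
have pair := curvature_pair_symmetry skew1 skew2 bianchi.
have rD2 a b b' c' d : r a (b + b') c' d = r a b c' d + r a b' c' d.
  by rewrite skew1 rD1 opprD -!skew1.
have rD4 a b c' d d' : r a b c' (d + d') = r a b c' d + r a b c' d'.
  by rewrite skew2 rD3 opprD -!skew2.
have rN1 a b c' d : r (- a) b c' d = - r a b c' d.
  have r0 : r 0 b c' d = 0 by apply: (addIr (r 0 b c' d)); rewrite -rD1 !add0r.
  by apply: (addIr (r a b c' d)); rewrite -rD1 !addNr.
have rN2 a b c' d : r a (- b) c' d = - r a b c' d.
  by rewrite skew1 rN1 -skew1.
have rN3 a b c' d : r a b (- c') d = - r a b c' d.
  by rewrite pair rN1 -pair.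
have rN4 a b c' d : r a b c' (- d) = - r a b c' d.
  by rewrite pair rN2 -pair.
have JN x : J (- x) = - J x.
  have J0 : J 0 = 0 by apply: (addIr (J 0)); rewrite -JD !add0r.
  by apply: (addIr (J x)); rewrite -JD !addNr.
have rJ1 a b c' d : r (J a) (J b) c' d = r a b c' d.
  by rewrite pair rJ -pair.
have key X Y : q (X + Y) = q X + q Y -> q (X - Y) = q X + q Y ->
    r X (J X) (J Y) Y + 2 * r X (J Y) (J Y) X = 4 * c * q X * q Y.
  move=> qD qB.
  have hD := hol (X + Y); have hB := hol (X - Y).
  have hX := hol X; have hY := hol Y.
  rewrite qD qB in hD hB.
  rewrite !(JD, JN, rD1, rD2, rD3, rD4, rN1, rN2, rN3, rN4) in hD hB.
  have e1 : r Y (J Y) (J X) X = r X (J X) (J Y) Y.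
    by rewrite pair skew1; have := skew2 X (J X) Y (J Y); lra.
  have e2 : r Y (J X) (J X) Y = r X (J Y) (J Y) X.
    rewrite -[LHS]rJ1 JJ rN2 -rJ JJ rN3 opprK.
    have := skew1 (J Y) X X (J Y); have := skew2 X (J Y) X (J Y); lra.
  have e3 : r X (J Y) (J X) Y = r X (J Y) (J Y) X.
    by rewrite -[LHS]rJ JJ rN3 -skew2. 
  have e4 : r Y (J X) (J Y) X = r X (J Y) (J Y) X.
    by rewrite -[LHS]rJ JJ rN3 -skew2 e2. 
  lra.
move=> X Y qD qB qDJ qBJ.
have k1 := key _ _ qD qB.
have k2 : r X (J X) (J Y) Y + 2 * r X Y Y X = 4 * c * q X * q Y.
  have := key X (J Y); rewrite qJ qDJ qBJ => /(_ erefl erefl).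
  rewrite JJ !(rN2, rN3) opprK; have := skew2 X (J X) Y (J Y); lra.
have b := bianchi X (J X) (J Y) Y.
have e1 : r (J X) (J Y) X Y = - r X Y Y X.
  by rewrite rJ1 skew2.
have e2 : r (J Y) X (J X) Y = - r X (J Y) (J Y) X.
  by rewrite skew1 -[X in - X]rJ JJ rN3 opprK skew2.
lra.
Qed.

(** * Curvature of a connection *)

Lemma mx_addE (R : zmodType) (m n : nat) (A B : 'M[R]_(m, n)) i j :
  (A + B) i j = A i j + B i j.
Proof. by rewrite mxE. Qed.

Lemma mx_oppE (R : zmodType) (m n : nat) (A : 'M[R]_(m, n)) i j :
  (- A) i j = - A i j.
Proof. by rewrite mxE. Qed.

Lemma trmx_addE (R : zmodType) (m n : nat) (A B : 'M[R]_(m, n)) :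
  (A + B)^T = A^T + B^T.
Proof. by apply/matrixP => i j; rewrite !mxE. Qed.

Lemma trmx_oppE (R : zmodType) (m n : nat) (A : 'M[R]_(m, n)) :
  (- A)^T = - A^T.
Proof. by apply/matrixP => i j; rewrite !mxE. Qed.

Definition mx_entryE := (mx_addE, mx_oppE).

Definition mx_pushE := (mulmxDl, mulmxDr, mulNmx, mulmxN, mulmxA).

(** The curvature matrix of the connection matrices [C].  As vectors are rows,
on which matrices act from the right, the product of the connection matrices
appears in the reverse of the usual order. *)
Definition curv (R : realType) (k : nat)
    (C : 'rV[R]_k -> 'rV[R]_k -> 'M[R]_k) (z u v : 'rV[R]_k) : 'M[R]_k :=
  'D_u (fun y => C y v) z - 'D_v (fun y => C y u) z
  + (C z v *m C z u - C z u *m C z v).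

Lemma derive_mulmxl (R : realType) (V : normedModType R) (m n p : nat)
    (B : 'M[R]_(m, n)) (f : V -> 'M[R]_(n, p)) (x v : V) :
  differentiable f x -> 'D_v (fun z => B *m f z) x = B *m 'D_v f x.
Proof.
move=> df; rewrite derive_mulmx //.
by rewrite derive_cst mul0mx add0r.
Qed.

Lemma curv_antisym (R : realType) (k : nat)
    (C : 'rV[R]_k -> 'rV[R]_k -> 'M[R]_k) (z u v : 'rV[R]_k) :
  curv C z u v = - curv C z v u.
Proof. by rewrite /curv opprD !opprB. Qed.

Lemma curv_additive (R : realType) (k : nat) (U : set 'rV[R]_k)
    (C : 'rV[R]_k -> 'rV[R]_k -> 'M[R]_k) (z u u' v : 'rV[R]_k) :
  open U -> U z -> (forall w, smooth_on U (fun y => C y w)) ->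
  (forall y, U y -> linear (C y)) ->
  curv C z (u + u') v = curv C z u v + curv C z u' v.
Proof.
move=> oU Uz cC lC.
have dC w : differentiable (fun y => C y w) z.
  exact: smooth_on_differentiable (cC w) Uz.
have DC w y : U y -> C y (u + w) = C y u + C y w.
  by move=> Uy; have := lC y Uy 1 u w; rewrite !scale1r.
have E1 : 'D_v (fun y => C y (u + u')) z
    = 'D_v (fun y => C y u) z + 'D_v (fun y => C y u') z.
  rewrite -deriveD; [|exact: diff_derivable..].
  by apply: near_eq_derive; apply: (near_open oU Uz) => y Uy; exact: DC.
have E2 : 'D_(u + u') (fun y => C y v) z
    = 'D_u (fun y => C y v) z + 'D_u' (fun y => C y v) z.
  by have := derive_linear (dC v) 1 u u'; rewrite !scale1r.
rewrite /curv E1 E2 (DC u' z Uz) {E1 E2}.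
move: ('D_u _ z) ('D_u' _ z) ('D_v _ z) ('D_v _ z) => a b d e.
by apply/matrixP => i j; rewrite !mx_pushE !mx_entryE; lra.
Qed.

(** Torsion-freeness makes both the differentiated terms and the quadratic
terms cancel in pairs. *)
Lemma curv_bianchi (R : realType) (k : nat) (U : set 'rV[R]_k)
    (C : 'rV[R]_k -> 'rV[R]_k -> 'M[R]_k) (z u v w : 'rV[R]_k) :
  open U -> U z -> (forall w, smooth_on U (fun y => C y w)) ->
  (forall y a b, U y -> a *m C y b = b *m C y a) ->
  w *m curv C z u v + u *m curv C z v w + v *m curv C z w u = 0.
Proof.
move=> oU Uz cC torsion.
have dC a : differentiable (fun y => C y a) z.
  exact: smooth_on_differentiable (cC a) Uz.
pose dd a b := 'D_a (fun y => C y b) z.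
have E a b c : a *m dd c b = b *m dd c a.
  apply: etrans (esym (derive_mulmxl a c (dC b))) _.
  apply: etrans _ (derive_mulmxl b c (dC a)); apply: near_eq_derive.
  by apply: (near_open oU Uz) => y Uy; exact: torsion.
have T a b := torsion z a b Uz.
have curvE a b : curv C z a b = dd a b - dd b a
  + (C z b *m C z a - C z a *m C z b) by [].
rewrite !curvE; clearbody dd => {curvE}.
rewrite !mulmxDr !mulmxN (E w v) (E u w) (E v u) {E} !mulmxA.
rewrite (T w v) (T u w) (T v u).
by apply/matrixP => i j; rewrite !mx_entryE [RHS]mxE; lra.
Qed.

(** Differentiate the compatibility of [C] with [G] once more: the left-hand
side is symmetric in [u] and [v] by [schwarz_mx], and its antisymmetric part
is the assertion. *)
Lemma curv_skew (R : realType) (k : nat) (U : set 'rV[R]_k)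
    (C : 'rV[R]_k -> 'rV[R]_k -> 'M[R]_k) (G : 'rV[R]_k -> 'M[R]_k)
    (z u v : 'rV[R]_k) :
  open U -> U z -> (forall w, smooth_on U (fun y => C y w)) ->
  smooth_on U G ->
  (forall y a, U y -> 'D_a G y = C y a *m G y + G y *m (C y a)^T) ->
  curv C z u v *m G z + G z *m (curv C z u v)^T = 0.
Proof.
move=> oU Uz cC cG compat.
have dC a : differentiable (fun y => C y a) z.
  exact: smooth_on_differentiable (cC a) Uz.
have dG : differentiable G z by exact: smooth_on_differentiable cG Uz.
have dCT a : differentiable (fun y => (C y a)^T) z.
  by apply: smooth_on_differentiable Uz; exact: smooth_on_trmx.
have DD a b : 'D_a ('D_b G) z
    = 'D_a (fun y => C y b) z *m G z + C z b *m 'D_a G z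
      + ('D_a G z *m (C z b)^T + G z *m ('D_a (fun y => C y b) z)^T).
  have -> : 'D_a ('D_b G) z
      = 'D_a (fun y => C y b *m G y + G y *m (C y b)^T) z.
    apply: near_eq_derive; apply: (near_open oU Uz) => y Uy.
    exact: compat.
  have d1 : derivable (fun y => C y b *m G y) z a.
    by apply: diff_derivable; apply: (smooth_on_differentiable _ Uz);
       exact: smooth_on_mulmx.
  have d2 : derivable (fun y => G y *m (C y b)^T) z a.
    apply: diff_derivable; apply: (smooth_on_differentiable _ Uz).
    by apply: smooth_on_mulmx => //; exact: smooth_on_trmx.
  by rewrite (deriveD d1 d2) !derive_mulmx // derive_trmx.
have := schwarz_mx u v oU Uz cG.
rewrite (DD u v) (DD v u) (compat z u Uz) (compat z v Uz) /curv {DD compat}.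
move: ('D_u _ z) ('D_v _ z) => a b.
rewrite !(trmx_addE, trmx_oppE, trmx_mul) !mx_pushE => H.
apply/matrixP => i j; move/matrixP/(_ i j): H.
by rewrite !mx_entryE [X in _ -> _ = X]mxE; lra.
Qed.

(** Same argument as for [curv_skew], starting from the parallelism of [J]. *)
Lemma curv_commute (R : realType) (k : nat) (U : set 'rV[R]_k)
    (C : 'rV[R]_k -> 'rV[R]_k -> 'M[R]_k) (J : 'rV[R]_k -> 'M[R]_k)
    (z u v : 'rV[R]_k) :
  open U -> U z -> (forall w, smooth_on U (fun y => C y w)) ->
  smooth_on U J ->
  (forall y a, U y -> 'D_a J y = C y a *m J y - J y *m C y a) ->
  curv C z u v *m J z = J z *m curv C z u v.
Proof.
move=> oU Uz cC cJ parJ.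
have dC a : differentiable (fun y => C y a) z.
  exact: smooth_on_differentiable (cC a) Uz.
have dJ : differentiable J z by exact: smooth_on_differentiable cJ Uz.
have DD a b : 'D_a ('D_b J) z
    = 'D_a (fun y => C y b) z *m J z + C z b *m 'D_a J z
      - ('D_a J z *m C z b + J z *m 'D_a (fun y => C y b) z).
  have -> : 'D_a ('D_b J) z
      = 'D_a (fun y => C y b *m J y - J y *m C y b) z.
    apply: near_eq_derive; apply: (near_open oU Uz) => y Uy.
    exact: parJ.
  have d1 : derivable (fun y => C y b *m J y) z a.
    by apply: diff_derivable; apply: (smooth_on_differentiable _ Uz);
       exact: smooth_on_mulmx.
  have d2 : derivable (fun y => J y *m C y b) z a.
    by apply: diff_derivable; apply: (smooth_on_differentiable _ Uz);
       exact: smooth_on_mulmx.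
  by rewrite (deriveB d1 d2) !derive_mulmx.
have := schwarz_mx u v oU Uz cJ.
rewrite (DD u v) (DD v u) (parJ z u Uz) (parJ z v Uz) /curv {DD parJ}.
move: ('D_u _ z) ('D_v _ z) => a b.
rewrite !mx_pushE !opprD !opprK => H.
apply/matrixP => i j; move/matrixP/(_ i j): H.
by rewrite !mx_entryE; lra.
Qed.

(** * Connections along an immersion *)

Lemma mx_scaleE (R : pzRingType) (m n : nat) (a : R) (A : 'M[R]_(m, n)) i j :
  (a *: A) i j = a * A i j.
Proof. by rewrite mxE. Qed.

Lemma form_addr (R : realType) (m : nat) (B : 'M[R]_m) (a b d : 'rV[R]_m) :
  form B a (b + d) = form B a b + form B a d.
Proof. by rewrite /form trmx_addE mulmxDr mx_addE. Qed.

Lemma form_addl (R : realType) (m : nat) (B : 'M[R]_m) (a b d : 'rV[R]_m) :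
  form B (a + b) d = form B a d + form B b d.
Proof. by rewrite /form !mulmxDl mx_addE. Qed.

Lemma form_oppr (R : realType) (m : nat) (B : 'M[R]_m) (a b : 'rV[R]_m) :
  form B a (- b) = - form B a b.
Proof. by rewrite /form trmx_oppE mulmxN mx_oppE. Qed.

Lemma form_oppl (R : realType) (m : nat) (B : 'M[R]_m) (a b : 'rV[R]_m) :
  form B (- a) b = - form B a b.
Proof. by rewrite /form !mulNmx mx_oppE. Qed.

Lemma form_scaler (R : realType) (m : nat) (B : 'M[R]_m) (t : R)
    (a b : 'rV[R]_m) :
  form B a (t *: b) = t * form B a b.
Proof. by rewrite /form linearZ -scalemxAr mxE. Qed.

Lemma derive_scale (R : realType) (V : normedModType R) (m n : nat)
    (f : V -> R) (g : V -> 'M[R]_(m, n)) (x v : V) :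
  differentiable f x -> differentiable g x ->
  'D_v (fun z => f z *: g z) x = 'D_v f x *: g x + f x *: 'D_v g x.
Proof.
move=> df dg; have dg' := (differentiable_mxP g x).1 dg.
have fgE i j : (fun z => (f z *: g z) i j) = f * (fun z => g z i j).
  by apply/funext => z; rewrite mxE.
have dfg : differentiable (fun z => f z *: g z) x.
  by apply/differentiable_mxP => i j; rewrite fgE; exact: differentiableM.
apply/matrixP => i j; rewrite (derive_coord _ _ _ dfg) fgE.
have df1 : derivable f x v := diff_derivable df.
have dg1 : derivable (fun z => g z i j) x v := diff_derivable (dg' i j).
rewrite (deriveM df1 dg1).
rewrite mx_addE !mx_scaleE (derive_coord _ _ _ dg) addrC.
by congr (_ + _); exact: mulrC.
Qed.

Section AlongMap.
Variables (R : realType) (n k : nat).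
Variables (O : set 'rV[R]_n) (U : set 'rV[R]_k) (phi : 'rV[R]_n -> 'rV[R]_k).
Variable C : 'rV[R]_k -> 'rV[R]_k -> 'M[R]_k.
Hypotheses (openO : open O) (openU : open U).
Hypotheses (phiOU : forall p, O p -> U (phi p)) (smooth_phi : smooth_on O phi).
Hypothesis smoothC : forall w, smooth_on U (fun z => C z w).
Hypothesis linearC : forall z, U z -> linear (C z).

(** [C z x] depends linearly on [x]; this splits the joint dependence on the
point and on the direction into products that the calculus can differentiate.
*)
Lemma conn_row_sum (z x : 'rV[R]_k) : U z ->
  C z x = \sum_i x 0 i *: C z (delta_mx 0 i).
Proof.
move=> Uz; pose HC := GRing.isLinear.Build R _ _ _ _ (linearC Uz).
pose Cz : {linear 'rV[R]_k -> 'M[R]_k} := HB.pack (C z) HC.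
rewrite -[C z x]/(Cz x) {1}(row_sum_delta x) linear_sum.
by apply: eq_bigr => i _; rewrite linearZ.
Qed.

Lemma smooth_conn_along (X : 'rV[R]_n -> 'rV[R]_k) : smooth_on O X ->
  smooth_on O (fun p => C (phi p) (X p)).
Proof.
move=> sX.
have H : smooth_on O
    (fun p => \sum_(i < k) X p 0 i *: C (phi p) (delta_mx 0 i)).
  apply: smooth_on_sum => // i; apply: smooth_onZ => //.
    exact: (smooth_on_mx X openO).1.
  exact: (smooth_on_comp openO openU phiOU smooth_phi (smoothC (delta_mx 0 i))).
apply: (smooth_on_eq openO _ H) => p Op.
by rewrite -conn_row_sum //; exact: phiOU.
Qed.

Lemma derive_along (m1 m2 : nat) (F : 'rV[R]_k -> 'M[R]_(m1, m2))
    (p u : 'rV[R]_n) : O p -> smooth_on U F ->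
  'D_u (fun q => F (phi q)) p = 'D_('D_u phi p) F (phi p).
Proof.
move=> Op sF; apply: (@derive_comp _ _ _ _ phi F).
  exact: smooth_on_differentiable smooth_phi Op.
exact: smooth_on_differentiable sF (phiOU Op).
Qed.

Lemma derive_conn_along (X : 'rV[R]_n -> 'rV[R]_k) (p u : 'rV[R]_n) :
  O p -> smooth_on O X ->
  'D_u (fun q => C (phi q) (X q)) p
  = 'D_('D_u phi p) (fun z => C z (X p)) (phi p) + C (phi p) ('D_u X p).
Proof.
move=> Op sX; have Uz := phiOU Op.
have dX : differentiable X p by exact: smooth_on_differentiable sX Op.
have dXi i : differentiable (fun q => X q 0 i) p.
  by move/differentiable_mxP: dX.
have sCi i : smooth_on O (fun q => C (phi q) (delta_mx 0 i)).
  exact: (smooth_on_comp openO openU phiOU smooth_phi (smoothC (delta_mx 0 i))).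
have dCi i : differentiable (fun q => C (phi q) (delta_mx 0 i)) p.
  exact: smooth_on_differentiable (sCi i) Op.
have dC w : differentiable (fun z => C z w) (phi p).
  exact: smooth_on_differentiable (smoothC w) Uz.
have sumD (I : finType) (V W : normedModType R) (h : 'I_k -> V -> W) x v :
    (forall i, differentiable (h i) x) ->
    'D_v (fun q => \sum_i h i q) x = \sum_i 'D_v (h i) x.
  move=> dh; have -> : (fun q => \sum_i h i q) = \sum_i h i.
    by apply/funext => q; rewrite fct_sumE.
  by apply: derive_sum => i; exact: diff_derivable.
have dZ i : differentiable (fun q => X q 0 i *: C (phi q) (delta_mx 0 i)) p.
  apply: (smooth_on_differentiable _ Op); apply: smooth_onZ => //.
  exact: (smooth_on_mx X openO).1.
transitivity ('D_u (fun q => \sum_i X q 0 i *: C (phi q) (delta_mx 0 i)) p).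
  apply: near_eq_derive; apply: (near_open openO Op) => q Oq.
  exact: conn_row_sum (phiOU Oq).
transitivity (\sum_i ('D_u X p 0 i *: C (phi p) (delta_mx 0 i)
   + X p 0 i *: 'D_('D_u phi p) (fun z => C z (delta_mx 0 i)) (phi p))).
  rewrite (sumD 'I_k) //; apply: eq_bigr => i _.
  rewrite (derive_scale _ (dXi i) (dCi i)) -(derive_coord _ _ _ dX).
  by rewrite (derive_along u Op (smoothC (delta_mx 0 i))).
rewrite big_split addrC -conn_row_sum //; congr (_ + _).
transitivity ('D_('D_u phi p)
    (fun z => \sum_i X p 0 i *: C z (delta_mx 0 i)) (phi p)).
  rewrite (sumD 'I_k); last first.
    by move=> i; exact: (differentiableZ _ (dC (delta_mx 0 i))).
  apply: eq_bigr => i _.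
  rewrite (@deriveZ _ _ _ (fun z => C z (delta_mx 0 i))) //.
  exact: diff_derivable.
apply: near_eq_derive; apply: (near_open openU Uz) => z Uz'.
exact: esym (conn_row_sum _ Uz').
Qed.

(** The covariant derivative along [phi], in the direction [u], of the field
[W] along [phi]. *)
Definition cov (u : 'rV[R]_n) (W : 'rV[R]_n -> 'rV[R]_k) (p : 'rV[R]_n) :
  'rV[R]_k := 'D_u W p + W p *m C (phi p) ('D_u phi p).

Lemma smooth_cov (u : 'rV[R]_n) (W : 'rV[R]_n -> 'rV[R]_k) :
  smooth_on O W -> smooth_on O (cov u W).
Proof.
move=> sW; apply: smooth_onD => //; first exact: smooth_on_derive.
apply: smooth_on_mulmx => //; apply: smooth_conn_along.
exact: smooth_on_derive.
Qed.

(** The connection matrices pulled back by [phi] have the pulled back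
curvature: the terms containing second derivatives of [phi] are symmetric in
[u] and [v], and drop out. *)
Lemma cov_commutator (W : 'rV[R]_n -> 'rV[R]_k) (p u v : 'rV[R]_n) :
  O p -> smooth_on O W ->
  cov u (cov v W) p - cov v (cov u W) p
  = W p *m curv C (phi p) ('D_u phi p) ('D_v phi p).
Proof.
move=> Op sW.
have dW : differentiable W p by exact: smooth_on_differentiable sW Op.
have sw b : smooth_on O (fun q => C (phi q) ('D_b phi q)).
  by apply: smooth_conn_along; exact: smooth_on_derive.
pose w1 a := 'D_a W p; pose w2 a b := 'D_a ('D_b W) p.
pose phi2 a b := C (phi p) ('D_a ('D_b phi) p).
pose om a := C (phi p) ('D_a phi p).
pose dC a b := 'D_('D_a phi p) (fun z => C z ('D_b phi p)) (phi p).
have derive_cov a b : 'D_a (cov b W) p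
    = w2 a b + (w1 a *m om b + W p *m (dC a b + phi2 a b)).
  have dw : differentiable (fun q => C (phi q) ('D_b phi q)) p.
    exact: smooth_on_differentiable (sw b) Op.
  have d1 : derivable ('D_b W) p a.
    apply: diff_derivable.
    exact: (smooth_on_differentiable (smooth_on_derive b sW) Op).
  have d2 : derivable (fun q => W q *m C (phi q) ('D_b phi q)) p a.
    apply: diff_derivable; apply: (smooth_on_differentiable _ Op).
    exact: smooth_on_mulmx.
  apply: etrans (deriveD d1 d2) _; congr (_ + _).
  apply: etrans (derive_mulmx a dW dw) _; congr (_ + _ *m _).
  exact: (derive_conn_along a Op (smooth_on_derive b smooth_phi)).
have cov2 a b : cov a (cov b W) p
    = w2 a b + (w1 a *m om b + W p *m (dC a b + phi2 a b))
      + (w1 b + W p *m om b) *m om a.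
  exact: (congr1 (fun X => X + _) (derive_cov a b)).
have curvE : curv C (phi p) ('D_u phi p) ('D_v phi p)
    = dC u v - dC v u + (om v *m om u - om u *m om v) by [].
have sym1 : w2 u v = w2 v u by exact: (schwarz_mx u v openO Op sW).
have sym2 : phi2 u v = phi2 v u.
  exact: (congr1 (C (phi p)) (schwarz_mx u v openO Op smooth_phi)).
rewrite (cov2 u v) (cov2 v u) curvE sym1 sym2.
move: (w2 v u) (phi2 v u) (w1 u) (w1 v) (om u) (om v) (dC u v) (dC v u).
move=> a b a1 b1 d e f g.
rewrite !mx_pushE; apply/matrixP => i j.
by rewrite !mx_entryE; lra.
Qed.

Variable G : 'rV[R]_k -> 'M[R]_k.
Hypothesis smoothG : smooth_on U G.
Hypothesis compatG : forall z a, U z ->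
  'D_a G z = C z a *m G z + G z *m (C z a)^T.

Lemma derive_form (V W : 'rV[R]_n -> 'rV[R]_k) (p u : 'rV[R]_n) :
  O p -> smooth_on O V -> smooth_on O W ->
  'D_u (fun q => form (G (phi q)) (V q) (W q)) p
  = form (G (phi p)) (cov u V p) (W p) + form (G (phi p)) (V p) (cov u W p).
Proof.
move=> Op sV sW.
have dV : differentiable V p by exact: smooth_on_differentiable sV Op.
have dW : differentiable W p by exact: smooth_on_differentiable sW Op.
have sGp := smooth_on_comp openO openU phiOU smooth_phi smoothG.
have dGp := smooth_on_differentiable sGp Op.
have sVG := smooth_on_mulmx openO sV sGp.
have dVG := smooth_on_differentiable sVG Op.
have sWT := smooth_on_trmx openO sW.
have dWT := smooth_on_differentiable sWT Op.
have sF := smooth_on_mulmx openO sVG sWT.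
have dF := smooth_on_differentiable sF Op.
apply: etrans (esym (derive_coord u 0 0 dF)) _.
rewrite (derive_mulmx u dVG dWT) (derive_mulmx u dV dGp) (derive_trmx u dW).
rewrite (derive_along u Op smoothG) (compatG _ (phiOU Op)) /form /cov.
move: ('D_u V p) ('D_u W p) ('D_u phi p) => a b d.
by rewrite !(trmx_addE, trmx_mul) !mx_pushE !mx_entryE; lra.
Qed.

Variable J : 'rV[R]_k -> 'M[R]_k.
Hypothesis smoothJ : smooth_on U J.
Hypothesis parallelJ : forall z a, U z ->
  'D_a J z = C z a *m J z - J z *m C z a.

Lemma cov_mulJ (W : 'rV[R]_n -> 'rV[R]_k) (p u : 'rV[R]_n) :
  O p -> smooth_on O W ->
  cov u (fun q => W q *m J (phi q)) p = cov u W p *m J (phi p).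
Proof.
move=> Op sW.
have dW : differentiable W p by exact: smooth_on_differentiable sW Op.
have sJp := smooth_on_comp openO openU phiOU smooth_phi smoothJ.
have dJp := smooth_on_differentiable sJp Op.
rewrite /cov (derive_mulmx u dW dJp) (derive_along u Op smoothJ).
rewrite (parallelJ _ (phiOU Op)).
move: ('D_u W p) ('D_u phi p) => a d.
by rewrite !mx_pushE; apply/matrixP => i j; rewrite !mx_entryE; lra.
Qed.

Hypothesis torsionC : forall z a b, U z -> a *m C z b = b *m C z a.
Hypothesis symG : forall z, U z -> (G z)^T = G z.

Local Notation P := (fun p => 'J phi p).

Definition pullback_metric (p : 'rV[R]_n) : 'M[R]_n :=
  'J phi p *m G (phi p) *m ('J phi p)^T.

Lemma mul_jacobian (p u : 'rV[R]_n) : O p -> u *m 'J phi p = 'D_u phi p.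
Proof.
move=> Op; rewrite deriveEjacobian //.
exact: smooth_on_differentiable smooth_phi Op.
Qed.

Lemma smooth_jacobian : smooth_on O P.
Proof.
apply/smooth_on_mx => // i j.
have s1 : smooth_on O (fun q => ('D_(delta_mx 0 i) phi q) 0 j).
  apply: ((smooth_on_mx ('D_(delta_mx 0 i) phi) openO).1).
  exact: smooth_on_derive.
apply: (smooth_on_eq openO _ s1) => q Oq.
by rewrite -mul_jacobian // -rowE mxE.
Qed.

Lemma smooth_pullback_metric : smooth_on O pullback_metric.
Proof.
have sGp := smooth_on_comp openO openU phiOU smooth_phi smoothG.
apply: (smooth_on_mulmx openO); last exact: smooth_on_trmx smooth_jacobian.
exact: (smooth_on_mulmx openO smooth_jacobian).
Qed.

Lemma pullback_metric_sym (p : 'rV[R]_n) : O p ->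
  (pullback_metric p)^T = pullback_metric p.
Proof.
move=> Op; rewrite /pullback_metric !trmx_mul trmxK symG ?mulmxA //.
exact: phiOU.
Qed.

(** The tangential part of [cov] on tangent fields is torsion-free, since
second derivatives of [phi] are symmetric and the ambient connection is
torsion-free, and it is compatible with the pulled back metric; by
[levi_civita_unique] it is the Levi-Civita connection of this metric. *)
Lemma gauss_formula (X : 'rV[R]_n -> 'rV[R]_n) (p u w : 'rV[R]_n) :
  O p -> smooth_on O X -> pullback_metric p \in unitmx ->
  form (G (phi p)) (cov u (fun q => X q *m 'J phi q) p) (w *m 'J phi p)
  = form (pullback_metric p) ('D_u X p + X p *m conn pullback_metric p u) w.
Proof.
move=> Op sX ug.
have dX : differentiable X p by exact: smooth_on_differentiable sX Op.
have dP := smooth_on_differentiable smooth_jacobian Op.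
have sGp := smooth_on_comp openO openU phiOU smooth_phi smoothG.
have dGp := smooth_on_differentiable sGp Op.
have sPG := smooth_on_mulmx openO smooth_jacobian sGp.
have dPG := smooth_on_differentiable sPG Op.
have dPT := smooth_on_differentiable (smooth_on_trmx openO smooth_jacobian) Op.
(* the rows of Q a are the ambient derivatives, in the direction a, of the
coordinate fields of M *)
pose Q a := 'D_a P p + 'J phi p *m C (phi p) ('D_a phi p).
pose S a := Q a *m G (phi p) *m ('J phi p)^T.
have DS a : 'D_a pullback_metric p = S a + (S a)^T.
  apply: etrans (derive_mulmx a dPG dPT) _.
  rewrite (derive_mulmx a dP dGp) (derive_trmx a dP).
  rewrite (derive_along a Op smoothG) (compatG _ (phiOU Op)) /S /Q.
  move: ('D_a P p) ('D_a phi p) => d b.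
  rewrite !(trmx_addE, trmx_mul, trmxK) (symG (phiOU Op)) !mx_pushE.
  by apply/matrixP => i j; rewrite !mx_entryE; lra.
have QT a b : a *m Q b = b *m Q a.
  have E c d : c *m Q d
      = 'D_d ('D_c phi) p + 'D_c phi p *m C (phi p) ('D_d phi p).
    rewrite /Q mulmxDr mulmxA mul_jacobian //; congr (_ + _).
    apply: etrans (esym (derive_mulmxl c d dP)) _; apply: near_eq_derive.
    by apply: (near_open openO Op) => q Oq; exact: mul_jacobian.
  rewrite (E a b) (E b a) (schwarz_mx b a openO Op smooth_phi).
  by rewrite (torsionC _ _ (phiOU Op)).
have connS a : conn pullback_metric p a *m pullback_metric p = S a.
  rewrite /conn mulmxKV //.
  apply: (levi_civita_unique DS) => b d.
  by rewrite /S !mulmxA QT.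
have covE : cov u (fun q => X q *m 'J phi q) p
    = 'D_u X p *m 'J phi p + X p *m Q u.
  rewrite /cov (derive_mulmx u dX dP) /Q.
  by rewrite [in RHS]mulmxDr !mulmxA addrA.
rewrite covE /form [in RHS]mulmxDl -[X p *m conn _ _ _ *m _]mulmxA connS /S.
rewrite /pullback_metric; move: ('D_u X p) (Q u) => a b.
by rewrite !trmx_mul !mx_pushE.
Qed.

Variables (A : 'rV[R]_n -> 'M[R]_n) (xi : 'rV[R]_n -> 'rV[R]_k).
Hypotheses (smoothA : smooth_on O A) (smooth_xi : smooth_on O xi).
Hypothesis unit_metric : forall p, O p -> pullback_metric p \in unitmx.
Hypothesis xi_unit : forall p, O p -> form (G (phi p)) (xi p) (xi p) = 1.
Hypothesis xi_normal : forall (p w : 'rV[R]_n), O p ->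
  form (G (phi p)) (xi p) (w *m 'J phi p) = 0.
Hypothesis weingarten : forall (p u w : 'rV[R]_n), O p ->
  form (G (phi p)) (cov u xi p + u *m A p *m 'J phi p) (w *m 'J phi p) = 0.
Hypothesis parallelA : forall (p u v : 'rV[R]_n), O p ->
  'D_u (fun q => v *m A q) p + v *m A p *m conn pullback_metric p u
  = v *m conn pullback_metric p u *m A p.
Hypothesis Jxi_tangent : forall p, O p ->
  exists w : 'rV[R]_n, xi p *m J (phi p) = w *m 'J phi p.
Hypothesis Jtangent : forall (p y : 'rV[R]_n), O p ->
  exists (w : 'rV[R]_n) (t : R),
    y *m 'J phi p *m J (phi p) = w *m 'J phi p + t *: xi p.

Definition normal_deriv (u p : 'rV[R]_n) : 'rV[R]_k :=
  cov u xi p + u *m A p *m 'J phi p.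

Lemma smooth_normal_deriv (u : 'rV[R]_n) : smooth_on O (normal_deriv u).
Proof.
apply: smooth_onD => //; first exact: smooth_cov.
apply: smooth_on_mulmx => //; last exact: smooth_jacobian.
by apply: smooth_on_mulmx => //; exact: smooth_on_cst.
Qed.

(** Differentiate [<xi, xi> = 1]. *)
Lemma normal_deriv_xi (p u : 'rV[R]_n) : O p ->
  form (G (phi p)) (normal_deriv u p) (xi p) = 0.
Proof.
move=> Op; have sG := symG (phiOU Op).
rewrite /normal_deriv form_addl (form_sym (u *m A p *m 'J phi p) (xi p) sG).
rewrite xi_normal // addr0.
have := derive_form u Op smooth_xi smooth_xi.
rewrite (form_sym (xi p) (cov u xi p) sG).
have -> : 'D_u (fun q => form (G (phi q)) (xi q) (xi q)) p = 0.
  rewrite -(derive_cst (1 : R) p u); apply: near_eq_derive.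
  by apply: (near_open openO Op) => q Oq; rewrite xi_unit.
by move=> H; lra.
Qed.

Lemma cov_add (V W : 'rV[R]_n -> 'rV[R]_k) (p u : 'rV[R]_n) : O p ->
  smooth_on O V -> smooth_on O W ->
  cov u (fun q => V q + W q) p = cov u V p + cov u W p.
Proof.
move=> Op sV sW; rewrite /cov.
have d1 : derivable V p u := smooth_on_derivable sV Op.
have d2 : derivable W p u := smooth_on_derivable sW Op.
rewrite (deriveD d1 d2); move: ('D_u V p) ('D_u W p) => a b.
by rewrite mulmxDl addrACA.
Qed.

(** The heart of the proof: the Codazzi equation for [xi], paired with [J xi],
at a point and for a direction [u] with [D_u xi = 0].  The two second
derivatives of [xi] that make up the curvature are split into derivatives of
[A]-terms and of normal terms.  Since [A] is parallel the [A]-terms agree; the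
normal terms vanish separately. *)
Lemma codazzi (p u v : 'rV[R]_n) : O p -> normal_deriv u p = 0 ->
  form (G (phi p)) (xi p *m curv C (phi p) ('D_u phi p) ('D_v phi p))
    (xi p *m J (phi p)) = 0.
Proof.
move=> Op Du0.
have sN b := smooth_normal_deriv b.
have sT (b : 'rV[R]_n) : smooth_on O (fun q => b *m A q *m 'J phi q).
  apply: smooth_on_mulmx => //; last exact: smooth_jacobian.
  by apply: smooth_on_mulmx => //; exact: smooth_on_cst.
have sbA (b : 'rV[R]_n) : smooth_on O (fun q => b *m A q).
  by apply: smooth_on_mulmx => //; exact: smooth_on_cst.
have sxiJ : smooth_on O (fun q => xi q *m J (phi q)).
  apply: smooth_on_mulmx => //.
  exact: (smooth_on_comp openO openU phiOU smooth_phi smoothJ).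
have split_cov a b : cov a (normal_deriv b) p
    = cov a (cov b xi) p + cov a (fun q => b *m A q *m 'J phi q) p.
  exact: (cov_add a Op (smooth_cov b smooth_xi) (sT b)).
have [w xiJ] := Jxi_tangent Op.
(* formula of Gauss, followed by the parallelism of A; by torsion-freeness the
result is symmetric in a and b *)
have tangential a b : form (G (phi p)) (cov a (fun q => b *m A q *m 'J phi q) p)
    (xi p *m J (phi p)) = form (pullback_metric p)
      (b *m conn pullback_metric p a *m A p) w.
  rewrite xiJ (gauss_formula a w Op (sbA b) (unit_metric Op)).
  by rewrite parallelA.
have dg := smooth_on_differentiable smooth_pullback_metric Op.
have symDg a :=
  derive_sym a openO Op smooth_pullback_metric pullback_metric_sym.
have swap : u *m conn pullback_metric p v = v *m conn pullback_metric p u.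
  exact: conn_torsion dg symDg.
(* differentiate the constant function <D_b xi, J xi> = 0 *)
have normal a b : form (G (phi p)) (cov a (normal_deriv b) p)
    (xi p *m J (phi p))
  = - form (G (phi p)) (normal_deriv b p) (cov a xi p *m J (phi p)).
  have := derive_form a Op (sN b) sxiJ.
  rewrite (cov_mulJ a Op smooth_xi).
  have -> : 'D_a (fun q => form (G (phi q)) (normal_deriv b q)
      (xi q *m J (phi q))) p = 0.
    rewrite -(derive_cst (0 : R) p a); apply: near_eq_derive.
    apply: (near_open openO Op) => q Oq.
    by have [y ->] := Jxi_tangent Oq; exact: weingarten.
  by move=> H; lra.
have covu : cov u xi p = - (u *m A p *m 'J phi p).
  by apply/eqP; rewrite -addr_eq0; apply/eqP.
(* the derivative of xi along u is tangent, and J maps it into the span of the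
tangent space and xi, both orthogonal to D_v xi *)
have Nv : form (G (phi p)) (normal_deriv v p) (cov u xi p *m J (phi p)) = 0.
  have [y [t E]] := Jtangent (u *m A p) Op.
  rewrite covu mulNmx E form_oppr form_addr form_scaler.
  rewrite normal_deriv_xi // mulr0 addr0.
  by rewrite weingarten // oppr0.
have Nu : form (G (phi p)) (normal_deriv u p) (cov v xi p *m J (phi p)) = 0.
  by rewrite Du0 /form !mul0mx mxE.
have key a b :
    form (G (phi p)) (normal_deriv b p) (cov a xi p *m J (phi p)) = 0 ->
    form (G (phi p)) (cov a (cov b xi) p) (xi p *m J (phi p))
    = - form (pullback_metric p) (b *m conn pullback_metric p a *m A p) w.
  move=> N0; have E := normal a b; rewrite N0 oppr0 in E.
  have F := etrans (congr1 (fun V => form (G (phi p)) V (xi p *m J (phi p)))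
    (split_cov a b)) (form_addl _ _ _ _).
  apply/eqP; rewrite -addr_eq0; apply/eqP.
  apply: etrans E; apply: etrans _ (esym F).
  exact: (congr1 (fun x => _ + x) (esym (tangential a b))).
rewrite -(cov_commutator u v Op smooth_xi) form_addl form_oppl.
apply: etrans (congr2 (fun x y => x - y) (key u v Nv) (key v u Nu)) _.
apply/eqP; rewrite subr_eq0; apply/eqP; congr (- _).
exact: (congr1 (fun X => form _ (X *m A p) w) (esym swap)).
Qed.

End AlongMap.

(** * Linear algebra at a point of a CR submanifold *)

Lemma form_mulmxl (R : realType) (m n : nat) (B : 'M[R]_m)
    (P : 'M[R]_(n, m)) (b : 'rV[R]_m) :
  (forall w, form B (w *m P) b = 0) -> P *m B *m b^T = 0.
Proof.
move=> H; apply/colP => i; rewrite [RHS]mxE -(H (delta_mx 0 i)) /form.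
by rewrite -!mulmxA -rowE [RHS]mxE.
Qed.

Section PointwiseCR.
Variables (R : realType) (n k : nat).
Variables (G J : 'M[R]_k) (P : 'M[R]_(n, k)) (xi : 'rV[R]_k).
Hypothesis symG : G^T = G.
Hypothesis JJ : J *m J = - 1%:M.
Hypothesis isometryJ : forall a b, form G (a *m J) (b *m J) = form G a b.
Hypothesis freeP : row_free P.
Hypothesis xi_unit : form G xi xi = 1.
Hypothesis xi_normal : forall w, form G xi (w *m P) = 0.
Hypothesis JP : (P *m J <= P + xi)%MS.

Lemma isometry_skew (a b : 'rV[R]_k) : form G (a *m J) b = - form G a (b *m J).
Proof.
by rewrite -[LHS]isometryJ -mulmxA JJ mulmxN mulmx1 form_oppl.
Qed.

Lemma J_decomp (w : 'rV[R]_n) : exists (v : 'rV[R]_n) (t : R),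
  w *m P *m J = v *m P + t *: xi.
Proof.
have : (w *m P *m J <= P + xi)%MS.
  by rewrite -mulmxA (submx_trans (submxMl _ _)).
move=> /sub_addsmxP[[v t] /= ->]; exists v, (t 0 0).
by rewrite [t in LHS]mx11_scalar mul_scalar_mx.
Qed.

(** As [J P] is not contained in [P], for dimension reasons, some tangent
vector [e] has [J e = w + t xi] with [w] tangent and [t <> 0].  Applying [J]
again shows that [t J xi] is tangent up to a multiple of [xi], and this
multiple vanishes because [J xi] is orthogonal to [xi]. *)
Lemma Jxi_in_tangent :
  (\rank (P *m J :&: P)%MS).+1 = n -> exists w, xi *m J = w *m P.
Proof.
move=> rk.
have uJ : J \in unitmx.
  have : J *m (- J) = 1%:M by rewrite mulmxN JJ opprK.
  by case/mulmx1_unit.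
have PJ : ~~ (P *m J <= P)%MS.
  apply/negP => /capmx_idPl eqPJ.
  move: rk; rewrite eqPJ mxrankMfree ?row_free_unit // (eqP freeP).
  by move=> /esym/n_Sn.
(* the rows of P are the coordinate vectors of the tangent space *)
have [i PJi] : exists i, ~~ (row i (P *m J) <= P)%MS.
  by apply/existsP; rewrite -negb_forall; apply: contra PJ => /forallP/row_subP.
move: PJi; rewrite rowE mulmxA.
have [w [t E]] := J_decomp (delta_mx 0 i).
have t0 : t != 0 -> exists w, xi *m J = w *m P.
  move=> t0; have [v [s F]] := J_decomp w.
  have H : t *: (xi *m J) = - (delta_mx 0 i + v) *m P - s *: xi.
    have := congr1 (fun X => X *m J) E.
    rewrite -[LHS]mulmxA JJ mulmxN mulmx1 mulmxDl F -scalemxAl => H.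
    rewrite mulNmx mulmxDl.
    move: H; move: (delta_mx 0 i *m P) (v *m P) (s *: xi) (t *: (xi *m J)).
    move=> a b d e H; apply/rowP => j; move/rowP/(_ j): H.
    by rewrite !mx_entryE; lra.
  have xiJxi : form G (xi *m J) xi = 0.
    by have := isometry_skew xi xi; rewrite (form_sym xi) //; lra.
  have s0 : s = 0.
    have := congr1 (fun X => form G xi X) H.
    rewrite form_scaler form_addr form_oppr form_scaler.
    by rewrite xi_normal xi_unit (form_sym xi) // xiJxi mulr0 mulr1; lra.
  exists (t^-1 *: - (delta_mx 0 i + v)).
  rewrite -scalemxAl; apply: (canRL (scalerK t0)).
  by rewrite H s0 scale0r subr0.
move=> PJi; apply: t0; apply: contra PJi => /eqP t0.
by rewrite E t0 scale0r addr0 submxMl.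
Qed.

Lemma holomorphic_tangent (u : 'rV[R]_n) : form G (u *m P *m J) xi = 0 ->
  exists v, u *m P *m J = v *m P.
Proof.
have [v [t ->]] := J_decomp u.
rewrite form_addl (form_sym _ xi) // xi_normal add0r.
rewrite form_sym // form_scaler xi_unit mulr1 => ->.
by exists v; rewrite scale0r addr0.
Qed.

(** Count of dimensions: the range of [D] is orthogonal to the [n + 1]
independent vectors made of the tangent space and [xi], so that [D] has rank
at most [p - 1]; one more linear condition leaves a nonzero kernel. *)
Lemma exists_null_direction (p : nat) (D : 'M[R]_(n, k)) :
  k = (n + p)%N -> (p < n)%N -> G \in unitmx ->
  (forall u w, form G (u *m D) (w *m P) = 0) ->
  (forall u, form G (u *m D) xi = 0) ->
  exists u, [/\ u != 0, u *m D = 0 & form G (u *m P *m J) xi = 0].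
Proof.
move=> kE pn uG DP Dxi.
pose N := col_mx P xi.
have freeN : row_free N.
  apply: inj_row_free => v; rewrite -[v]hsubmxK mul_row_col => E.
  have E2 : rsubmx v = 0.
    have := congr1 (fun X => form G xi X) E.
    rewrite form_addr xi_normal add0r [rsubmx v]mx11_scalar mul_scalar_mx.
    rewrite form_scaler.
    rewrite xi_unit mulr1 /form trmx0 mulmx0 [RHS]mxE => ->.
    exact: raddf0.
  move: E; rewrite E2 mul0mx addr0 => E.
  by rewrite (row_free_inj freeP (etrans E (esym (mul0mx _ _)))) row_mx0.
have DN : D *m (G *m N^T) = 0.
  rewrite tr_col_mx !mul_mx_row.
  have DGP (w : 'rV[R]_n) : D *m G *m (w *m P)^T = 0.
    by apply: form_mulmxl => u; exact: DP.
  have -> : D *m (G *m P^T) = 0.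
    apply/trmx_inj/row_matrixP => i; rewrite trmx0 row0 rowE.
    apply/trmx_inj; rewrite trmx_mul trmxK trmx0 -(DGP (delta_mx 0 i)).
    by rewrite trmx_mul !mulmxA.
  have -> : D *m (G *m xi^T) = 0.
    by rewrite mulmxA; apply: form_mulmxl => u; exact: Dxi.
  by rewrite row_mx0.
have rkD : (\rank D + n.+1 <= k)%N.
  have := mulmx0_rank_max DN.
  rewrite -[\rank (G *m _)]mxrank_tr trmx_mul trmxK symG.
  by rewrite mxrankMfree ?row_free_unit // (eqP freeN) addn1.
(* the last column is the condition that J u be orthogonal to xi *)
pose L := row_mx D (P *m J *m G *m xi^T).
have rkL : (\rank L < n)%N.
  apply: (@leq_ltn_trans (\rank D + 1)); last first.
    move: rkD pn kE; move: (\rank D) => d; lia.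
  rewrite -mxrank_tr tr_row_mx -addsmxE.
  apply: leq_trans (mxrank_adds_leqif _ _) _.
  by rewrite mxrank_tr leq_add2l rank_leq_row.
have : kermx L != 0 by rewrite kermx_eq0 /row_free neq_ltn rkL.
move=> /rowV0Pn[u /sub_kermxP uL u0]; exists u.
move: uL; rewrite mul_mx_row -[X in _ = X]row_mx0 => /eq_row_mx[uD uP].
split=> //; rewrite /form -!mulmxA; move: uP; rewrite -!mulmxA => ->.
by rewrite mxE.
Qed.

(** [bisectional_curvature] for [X] and the unit vector [xi]: the vanishing
curvature component equals [2 * c] times the square norm of [X], up to sign.
*)
Lemma space_form_null (K : 'rV[R]_k -> 'rV[R]_k -> 'M[R]_k) (c : R)
    (X : 'rV[R]_k) :
  (forall v, v != 0 -> 0 < form G v v) ->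
  (forall a a' b, K (a + a') b = K a b + K a' b) ->
  (forall a b, K a b = - K b a) ->
  (forall a b d, d *m K a b + a *m K b d + b *m K d a = 0) ->
  (forall a b, K a b *m G + G *m (K a b)^T = 0) ->
  (forall a b, K a b *m J = J *m K a b) ->
  (forall a, form G (a *m J *m K a (a *m J)) a = 4 * c * form G a a ^+ 2) ->
  X != 0 -> form G X xi = 0 -> form G (X *m J) xi = 0 ->
  form G (xi *m K X (X *m J)) (xi *m J) = 0 -> c = 0.
Proof.
move=> posG KD Kanti Kbianchi Kskew KJ hol X0 Xxi XJxi null.
pose r a b d e := form G (d *m K a b) e.
have skew a b d e : r a b d e = - r a b e d.
  rewrite /r [in RHS](form_sym _ d) // /form -form_oppr.
  have := congr1 (fun M => (d *m M *m e^T) 0 0) (Kskew a b).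
  rewrite mulmx0 mul0mx [RHS]mxE mulmxDr mulmxDl mx_addE !mulmxA.
  by rewrite /form trmx_oppE mulmxN mx_oppE trmx_mul !mulmxA; lra.
have qD a b : form G a b = 0 ->
    form G (a + b) (a + b) = form G a a + form G b b.
  by move=> h; rewrite form_addl !form_addr h (form_sym b a) // h addr0 add0r.
have qB a b : form G a b = 0 ->
    form G (a - b) (a - b) = form G a a + form G b b.
  by move=> h; rewrite qD ?form_oppr ?form_oppl ?opprK // h oppr0.
have XxiJ : form G X (xi *m J) = 0.
  by have := isometry_skew X xi; rewrite XJxi; lra.
have := @bisectional_curvature R _ (fun a => a *m J) r (fun a => form G a a) c.
have H1 (a : 'rV[R]_k) : a *m J *m J = - a by rewrite -mulmxA JJ mulmxN mulmx1.
have H2 : {morph (fun a : 'rV[R]_k => a *m J) : x y / x + y}.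
  by move=> a b; rewrite mulmxDl.
have H3 a a' b d e : r (a + a') b d e = r a b d e + r a' b d e.
  by rewrite /r KD mulmxDr form_addl.
have H4 a b d d' e : r a b (d + d') e = r a b d e + r a b d' e.
  by rewrite /r mulmxDl form_addl.
have H5 a b d e : r a b d e = - r b a d e.
  by rewrite /r Kanti mulmxN form_oppl.
have H6 a b d e : r a b d e + r b d a e + r d a b e = 0.
  by rewrite /r -!form_addl Kbianchi /form !mul0mx mxE.
have H7 a b d e : r a b (d *m J) (e *m J) = r a b d e.
  by rewrite /r -mulmxA -KJ mulmxA isometryJ.
move=> /(_ H1 H2 H3 H4 H5 skew H6 H7 hol (fun a => isometryJ a a) X xi).
rewrite qD // qB // [form G (X + _ *m J) _]qD // [form G (X - _ *m J) _]qB //.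
rewrite !isometryJ => /(_ erefl erefl erefl erefl).
rewrite skew /r null oppr0 xi_unit mulr1 => /esym/eqP.
by rewrite !mulf_eq0 (gt_eqF (posG _ X0)) orbF pnatr_eq0 /= => /eqP.
Qed.

End PointwiseCR.

(** * Tensor fields in a chart *)

Lemma param_image (R : realType) (T : topologicalType) (m : nat)
    (a : chart R T m) (W : set T) (z : 'rV[R]_m) : W `<=` dom a ->
  (coord a @` W) z -> W (param a z) /\ coord a (param a z) = z.
Proof.
by move=> Wa [x Wx <-]; rewrite coordK //; exact: Wa.
Qed.

(** Near the image of a point of [W], the image of [W] is the intersection of
the codomain with the preimage of [W] under the inverse of the chart. *)
Lemma open_chart_image (R : realType) (T : topologicalType) (m : nat)
    (a : chart R T m) (W : set T) : W `<=` dom a -> open W ->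
  open (coord a @` W).
Proof.
move=> Wa oW; rewrite openE => _ [x Wx <-].
have dx := Wa _ Wx.
have near_codom : nbhs (coord a x) (coord a @` dom a).
  by apply: open_nbhs_nbhs; split; [exact: codom_open|exists x].
have near_W : nbhs (coord a x) (param a @^-1` W).
  apply: (param_continuous dx); apply: open_nbhs_nbhs; split=> //.
  by rewrite coordK.
apply: filterS (filterI near_codom near_W) => z [[y dy <-]] /=.
by rewrite coordK // => Wy; exists y.
Qed.

Section ChartGeometry.
Variables (R : realType) (m : nat) (M : manifold R m) (g : tensor2 M).
Hypothesis riem : is_riemannian g.

Lemma smooth_gram (a : chart_of M) : atlas a ->
  smooth_on (coord a @` dom a) (g a \o param a).
Proof. by case: riem => _ + _ _; apply. Qed.

Lemma gram_sym (a : chart_of M) (z : 'rV[R]_m) : atlas a ->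
  (coord a @` dom a) z -> ((g a \o param a) z)^T = (g a \o param a) z.
Proof.
move=> aa /(param_image (@subset_refl _ _)) [dz _].
by case: riem => _ _ + _; apply.
Qed.

Lemma gram_unit (a : chart_of M) (z : 'rV[R]_m) : atlas a ->
  (coord a @` dom a) z -> (g a \o param a) z \in unitmx.
Proof.
move=> aa /(param_image (@subset_refl _ _)) [dz _] /=.
case: riem => _ _ _ pos; rewrite -row_free_unit; apply: inj_row_free => v vG.
apply/eqP; apply/negPn/negP => v0.
by have := pos _ _ _ (conj aa dz) v0; rewrite /form vG mul0mx mxE ltxx.
Qed.

Lemma christoffelE (a : chart_of M) (x : M) (v w : 'rV[R]_m) :
  chart_at a x ->
  christoffel g a x v w = w *m conn (g a \o param a) (coord a x) v.
Proof.
move=> [aa dx]; rewrite /conn mulmxA -christoffel1E; last first.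
  move=> u; apply: derive_row_sum.
  by apply: smooth_on_differentiable (smooth_gram aa) _; exists x.
by rewrite /christoffel /dmetric /= coordK.
Qed.

End ChartGeometry.

Section CoordinateField.
Variables (R : realType) (m : nat) (M : manifold R m) (a : chart_of M).
Hypothesis aa : atlas a.

(** The field with constant components [u] in the chart [a], expressed in all
charts. *)
Definition coord_vfield (u : 'rV[R]_m) : vfield M :=
  fun b x => u *m dmap (@id M) a b x.

Lemma transition_smooth (b : chart_of M) : atlas b ->
  smooth_on (coord a @` (dom a `&` dom b)) (coord b \o param a).
Proof. exact: atlas_smooth. Qed.

Lemma open_overlap (b b' : chart_of M) : open (coord b @` (dom b `&` dom b')).
Proof.
apply: open_chart_image; first by move=> x [].
by apply: openI; exact: dom_open.
Qed.

Lemma coord_vfieldE (u : 'rV[R]_m) (b : chart_of M) (x : M) : atlas b ->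
  dom a x -> dom b x ->
  coord_vfield u b x = 'D_u (coord b \o param a) (coord a x).
Proof.
move=> ab ax bx; rewrite [RHS]deriveEjacobian //.
by apply: smooth_on_differentiable (transition_smooth ab) _; exists x.
Qed.

Lemma coord_vfield_self (u : 'rV[R]_m) (x : M) : dom a x ->
  coord_vfield u a x = u.
Proof.
move=> ax; rewrite coord_vfieldE // -[RHS](derive_id (coord a x) u).
apply: near_eq_derive.
have Ux : (coord a @` dom a) (coord a x) by exists x.
apply: (near_open (@codom_open _ _ _ a) Ux) => z.
move=> /(param_image (@subset_refl _ _)) [_ h].
exact: h.
Qed.

End CoordinateField.

(** Consistency between charts is the chain rule for changes of coordinates.
In another chart [b] the components are the derivative of the change of
coordinates from [a] to [b], composed with the inverse change of coordinates,
hence smooth. *)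
Lemma coord_vfield_is_vfield (R : realType) (m : nat) (M : manifold R m)
    (a : chart_of M) (u : 'rV[R]_m) : atlas a ->
  is_vfield_on (dom a) (coord_vfield a u).
Proof.
move=> aa; split.
  move=> x b b' ax [ab bx] [ab' b'x].
  rewrite !coord_vfieldE // -[RHS]deriveEjacobian; last first.
    by apply: smooth_on_differentiable (transition_smooth ab ab') _; exists x.
  have Eb : coord b x = (coord b \o param a) (coord a x) by rewrite /= coordK.
  rewrite Eb -(@derive_comp _ _ _ _ (coord b \o param a) (coord b' \o param b)).
  - apply: near_eq_derive.
    have Ux : (coord a @` (dom a `&` dom b)) (coord a x) by exists x.
    apply: (near_open (@open_overlap _ _ M a b) Ux) => z.
    move=> /(param_image (@subIsetl _ _ _)) [[_ bz] _] /=.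
    by rewrite coordK.
  - by apply: smooth_on_differentiable (transition_smooth aa ab) _; exists x.
  - rewrite -Eb.
    by apply: smooth_on_differentiable (transition_smooth ab ab') _; exists x.
move=> b ab.
have s1 : smooth_on (coord b @` (dom b `&` dom a)) (coord a \o param b).
  exact: transition_smooth.
have s2 := smooth_on_derive u (transition_smooth aa ab).
have sub z : (coord b @` (dom b `&` dom a)) z ->
    (coord a @` (dom a `&` dom b)) ((coord a \o param b) z).
  by move=> /(param_image (@subIsetl _ _ _)) [[bz az] _]; exists (param b z).
have s3 := smooth_on_comp (@open_overlap _ _ M b a) (@open_overlap _ _ M a b)
  sub s1 s2.
rewrite setIC; apply: (smooth_on_eq (@open_overlap _ _ M b a) _ s3) => z.
move=> /(param_image (@subIsetl _ _ _)) [[bz az] _].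
by rewrite [RHS]/= coord_vfieldE.
Qed.

(** The parallelism of [A] is tested on fields with constant components in the
chart [a]. *)
Lemma parallel_in_chart (R : realType) (m : nat) (M : manifold R m)
    (g A : tensor2 M) (a : chart_of M) (z u v : 'rV[R]_m) :
  is_riemannian g -> parallel g A -> atlas a -> (coord a @` dom a) z ->
  'D_u (fun q => v *m A a (param a q)) z
    + v *m A a (param a z) *m conn (g a \o param a) z u
  = v *m conn (g a \o param a) z u *m A a (param a z).
Proof.
move=> riem parA aa Uz.
have [dz zE] := param_image (@subset_refl _ _) Uz.
have vf w := coord_vfield_is_vfield w aa.
have := parA (dom a) _ _ (@dom_open _ _ _ a) (vf u) (vf v) (param a z) a dz
  (conj aa dz).
move/eqP; rewrite subr_eq0 => /eqP.
rewrite /nabla /endo_app !christoffelE // !coord_vfield_self // zE.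
have -> : 'D_u (coord_vfield a v a \o param a) z = 0.
  rewrite -(derive_cst v z u); apply: near_eq_derive.
  apply: (near_open (@codom_open _ _ _ a) Uz) => q.
  move=> /(param_image (@subset_refl _ _)) [dq _].
  exact: coord_vfield_self.
rewrite add0r => <-; apply: (congr1 (fun X => X + _)); apply: near_eq_derive.
apply: (near_open (@codom_open _ _ _ a) Uz) => q.
  move=> /(param_image (@subset_refl _ _)) [dq _].
by rewrite /= coord_vfield_self.
Qed.

Lemma curvatureE (R : realType) (m : nat) (M : manifold R m)
    (g : tensor2 M) (a : chart_of M) (x : M) (u v w : 'rV[R]_m) :
  is_riemannian g -> chart_at a x ->
  curvature g a x u v w = w *m curv (conn (g a \o param a)) (coord a x) u v.
Proof.
move=> riem [aa dx].
have Ux : (coord a @` dom a) (coord a x) by exists x.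
have nabla1 (b d : 'rV[R]_m) y : dom a y ->
    nabla g (@const_vfield R m M b) (@const_vfield R m M d) a y
    = d *m conn (g a \o param a) (coord a y) b.
  move=> dy; rewrite /nabla christoffelE //.
  have -> : @const_vfield R m M d a \o param a = cst d by [].
  by rewrite derive_cst add0r.
have nabla2 (b d : 'rV[R]_m) :
    nabla g (@const_vfield R m M b)
      (nabla g (@const_vfield R m M d) (@const_vfield R m M w)) a x
    = w *m 'D_b (fun z => conn (g a \o param a) z d) (coord a x)
      + w *m conn (g a \o param a) (coord a x) d
          *m conn (g a \o param a) (coord a x) b.
  rewrite [LHS]/nabla christoffelE // nabla1 //; congr (_ + _).
  have sc := smooth_on_conn d (@codom_open _ _ _ a) (fun z => gram_unit riem aa)
    (smooth_gram riem aa).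
  have dc := smooth_on_differentiable sc Ux.
  apply: etrans _ (derive_mulmxl w b dc); apply: near_eq_derive.
  apply: (near_open (@codom_open _ _ _ a) Ux) => z.
  move=> /(param_image (@subset_refl _ _)) [dz zE].
  by rewrite /= nabla1 // zE.
rewrite /curvature nabla2 nabla2 /curv.
move: ('D_u _ _) ('D_v _ _) => b d.
by rewrite !mulmxDr !mulmxN !mulmxA; apply/rowP => i; rewrite !mx_entryE; lra.
Qed.

Section ChartConnection.
Variables (R : realType) (m : nat) (M : manifold R m) (g : tensor2 M).
Variable a : chart_of M.
Hypotheses (riem : is_riemannian g) (aa : atlas a).

Local Notation G := (g a \o param a).
Local Notation U := (coord a @` dom a).

Lemma metric_derive_sym (z u : 'rV[R]_m) : U z -> ('D_u G z)^T = 'D_u G z.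
Proof.
move=> Uz; apply: (derive_sym u (@codom_open _ _ _ a) Uz (smooth_gram riem aa)).
by move=> y; exact: (gram_sym riem aa).
Qed.

Lemma chart_conn_smooth (w : 'rV[R]_m) : smooth_on U (fun z => conn G z w).
Proof.
apply: smooth_on_conn (@codom_open _ _ _ a) _ (smooth_gram riem aa).
by move=> z; exact: (gram_unit riem aa).
Qed.

Lemma chart_conn_linear (z : 'rV[R]_m) : U z -> linear (conn G z).
Proof.
move=> Uz; apply: conn_linear.
exact: smooth_on_differentiable (smooth_gram riem aa) Uz.
Qed.

Lemma chart_conn_compat (z u : 'rV[R]_m) : U z ->
  'D_u G z = conn G z u *m G z + G z *m (conn G z u)^T.
Proof.
move=> Uz; apply: conn_compat; first exact: (gram_unit riem aa).
  exact: (gram_sym riem aa).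
exact: metric_derive_sym.
Qed.

Lemma chart_conn_torsion (z u v : 'rV[R]_m) : U z ->
  u *m conn G z v = v *m conn G z u.
Proof.
move=> Uz; apply: conn_torsion.
  exact: smooth_on_differentiable (smooth_gram riem aa) Uz.
by move=> w; exact: metric_derive_sym.
Qed.

(** The parallelism of [J] in the form required by [curv_commute] and
[cov_mulJ]. *)
Lemma parallel_commutator (J : tensor2 M) (z u : 'rV[R]_m) :
  is_endo J -> parallel g J -> U z ->
  'D_u (J a \o param a) z
  = conn G z u *m (J a \o param a) z - (J a \o param a) z *m conn G z u.
Proof.
move=> endoJ parJ Uz.
have dJ := smooth_on_differentiable (endoJ.2 a aa) Uz.
apply/row_matrixP => i.
rewrite !rowE mulmxBr (mulmxA _ (conn G z u)) (mulmxA _ _ (conn G z u)).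
apply: etrans (esym (derive_mulmxl (delta_mx 0 i) u dJ)) _.
apply: (canRL (addrK _)).
exact: (parallel_in_chart u (delta_mx 0 i) riem parJ aa Uz).
Qed.

End ChartConnection.

Lemma normal_deriv_linear (R : realType) (n k : nat)
    (phi xi : 'rV[R]_n -> 'rV[R]_k) (C : 'rV[R]_k -> 'rV[R]_k -> 'M[R]_k)
    (A : 'rV[R]_n -> 'M[R]_n) (p : 'rV[R]_n) :
  differentiable phi p -> differentiable xi p -> linear (C (phi p)) ->
  linear (fun u => normal_deriv phi C A xi u p).
Proof.
move=> dphi dxi lC t u v; rewrite /normal_deriv /cov.
rewrite (derive_linear dphi) (derive_linear dxi) lC.
move: ('D_u xi p) ('D_v xi p) ('D_u phi p) ('D_v phi p) => a b d e.
rewrite mulmxDr -scalemxAr !mulmxDl -!scalemxAl !scalerDr.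
by apply/rowP => i; rewrite !mx_entryE; lra.
Qed.

Lemma near_eq_conn (R : realType) (m : nat) (O : set 'rV[R]_m)
    (G H : 'rV[R]_m -> 'M[R]_m) (z u : 'rV[R]_m) : open O -> O z ->
  (forall y, O y -> G y = H y) -> conn G z u = conn H z u.
Proof.
move=> oO Oz GH.
have E : (fun w => 'D_w G z) = (fun w => 'D_w H z).
  apply/funext => w; apply: near_eq_derive; exact: (near_open oO Oz).
exact: (congr2 (fun D B => christoffel1 D u *m invmx B) E (GH z Oz)).
Qed.

(** * Codazzi equation in a complex space form *)

Theorem theorem3 (R : realType) (n p : nat) (c : R)
    (Mbar : manifold R (n + p)) (J gbar : tensor2 Mbar)
    (M : manifold R n) (f : M -> Mbar) (g : tensor2 M)
    (xi : vfield_along f) (A : tensor2 M)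
    (n_ge3 : (3 <= n)%N) (p_gt0 : (0 < p)%N)
    (Mbar_csf : complex_space_form J gbar c)
    (M_nonempty : [set: M] !=set0)
    (f_immersion : immersion f)
    (g_induced : is_induced_metric f gbar g)
    (M_CR : CR_max_dim f J)
    (xi_distinguished : distinguished J gbar xi)
    (A_shape : is_shape_operator gbar xi A)
    (p_lt_n : (p < n)%N)
    (A_parallel : parallel g A) :
  c = 0.
Proof.
have [[riem endoJ JJ isoJ parJ] hol] := Mbar_csf.
have [riemg gE] := g_induced.
have [[cont_f smooth_f] imm_f] := f_immersion.
have [[_ smooth_xi] dist_xi] := xi_distinguished.
have [endoA shapeA] := A_shape.
have [x0 _] := M_nonempty.
have [a aa ax0] := atlas_cover x0.
have [b ab bx0] := atlas_cover (f x0).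
pose W := dom a `&` f @^-1` dom b.
have Wa : W `<=` dom a by move=> x [].
have oW : open W.
  apply: openI; first exact: dom_open.
  by apply: open_comp; [move=> x _; exact: cont_f|exact: dom_open].
pose O := coord a @` W; pose U := coord b @` dom b.
pose phi := coord b \o f \o param a.
pose G := gbar b \o param b; pose Jb := J b \o param b.
pose C := conn G; pose xia := xi b \o param a; pose Aa := A a \o param a.
have oO : open O by exact: open_chart_image.
have oU : open U by exact: codom_open.
have inW q : O q -> [/\ dom a (param a q), dom b (f (param a q))
    & coord a (param a q) = q].
  by move=> /(param_image Wa) [[]].
have phiU q : O q -> U (phi q).
  by move=> /inW [_ bq _]; exists (f (param a q)).
have phiK q : O q -> param b (phi q) = f (param a q).
  by move=> /inW [_ bq _]; rewrite /phi /= coordK.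
have sphi : smooth_on O phi by exact: smooth_f.
have sG : smooth_on U G by exact: smooth_gram.
have sJ : smooth_on U Jb by exact: endoJ.2.
have sC w : smooth_on U (fun z => C z w) by exact: chart_conn_smooth.
have lC z : U z -> linear (C z) by move=> Uz; exact: chart_conn_linear.
have compat z u : U z -> 'D_u G z = C z u *m G z + G z *m (C z u)^T.
  by move=> Uz; exact: chart_conn_compat.
have torsion z u v : U z -> u *m C z v = v *m C z u.
  by move=> Uz; exact: (chart_conn_torsion riem ab).
have comm z u : U z -> 'D_u Jb z = C z u *m Jb z - Jb z *m C z u.
  by move=> Uz; exact: parallel_commutator.
have symG z : U z -> (G z)^T = G z by exact: gram_sym.
have sA : smooth_on O Aa.
  by apply: smooth_onS (endoA.2 a aa); exact: image_subset.
have sxi : smooth_on O xia by exact: smooth_xi.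
have chart_a q : O q -> chart_at a (param a q) by move=> /inW [].
have chart_b q : O q -> chart_at b (f (param a q)) by move=> /inW [].
have GE q : O q -> G (phi q) = gbar b (f (param a q)).
  by move=> Oq; rewrite /G /= phiK.
have JE q : O q -> Jb (phi q) = J b (f (param a q)).
  by move=> Oq; rewrite /Jb /= phiK.
have PE q : O q -> dmap f a b (param a q) = 'J phi q.
  by move=> /inW [_ _ qE]; rewrite /dmap qE.
have gpull q : O q -> pullback_metric phi G q = g a (param a q).
  move=> Oq; rewrite /pullback_metric (gE _ _ _ (chart_a _ Oq) (chart_b _ Oq)).
  by rewrite PE // GE.
have unit_g q : O q -> pullback_metric phi G q \in unitmx.
  move=> Oq; rewrite gpull //; have [aq _ qE] := inW q Oq.
  by apply: (gram_unit riemg aa); exists (param a q).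
have xi1 q : O q -> form (G (phi q)) (xia q) (xia q) = 1.
  move=> Oq; rewrite GE //.
  by have [] := dist_xi _ _ _ (chart_a _ Oq) (chart_b _ Oq).
have xiN (q w : 'rV[R]_n) : O q -> form (G (phi q)) (xia q) (w *m 'J phi q) = 0.
  move=> Oq; rewrite GE // -PE //.
  by have [_ + _] := dist_xi _ _ _ (chart_a _ Oq) (chart_b _ Oq); apply.
have JT q : O q -> ('J phi q *m Jb (phi q) <= 'J phi q + xia q)%MS.
  move=> Oq; rewrite JE // -PE //.
  by have [] := dist_xi _ _ _ (chart_a _ Oq) (chart_b _ Oq).
have JJq q : O q -> Jb (phi q) *m Jb (phi q) = - 1%:M.
  by move=> Oq; rewrite JE //; apply: JJ; exact: chart_b.
have isoq q u v : O q ->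
    form (G (phi q)) (u *m Jb (phi q)) (v *m Jb (phi q)) = form (G (phi q)) u v.
  by move=> Oq; rewrite JE // GE //; apply: isoJ; exact: chart_b.
have freeP q : O q -> row_free ('J phi q).
  by move=> Oq; rewrite -PE //; apply: imm_f; [exact: chart_a|exact: chart_b].
have Jxi q : O q -> exists w : 'rV[R]_n, xia q *m Jb (phi q) = w *m 'J phi q.
  move=> Oq; apply: (Jxi_in_tangent (symG _ (phiU _ Oq)) (JJq _ Oq)) => //.
  - by move=> u v; exact: isoq.
  - exact: freeP.
  - exact: xi1.
  - by move=> w; exact: xiN.
  - exact: JT.
  by rewrite JE // -PE //; apply: M_CR; [exact: chart_a|exact: chart_b].
have weingarten (q u w : 'rV[R]_n) : O q ->
    form (G (phi q)) (cov phi C u xia q + u *m Aa q *m 'J phi q)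
      (w *m 'J phi q) = 0.
  move=> Oq; have [_ _ qE] := inW _ Oq.
  have [D normalD] := shapeA _ _ _ u (chart_a _ Oq) (chart_b _ Oq).
  rewrite /nabla_along (christoffelE riem _ _ (chart_b _ Oq)) qE PE //.
  rewrite (mul_jacobian sphi u Oq) => E.
  have -> : cov phi C u xia q + u *m Aa q *m 'J phi q = D.
    rewrite /cov; apply: etrans (congr1 (fun X => X + _) E) _.
    by rewrite addrC addNKr.
  by rewrite (GE q Oq) -(PE q Oq); exact: (normalD w).
have parA (q u v : 'rV[R]_n) : O q ->
    'D_u (fun r => v *m Aa r) q
      + v *m Aa q *m conn (pullback_metric phi G) q u
    = v *m conn (pullback_metric phi G) q u *m Aa q.
  move=> Oq.
  have -> : conn (pullback_metric phi G) q u = conn (g a \o param a) q u.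
    exact: near_eq_conn oO Oq gpull.
  apply: (parallel_in_chart u v riemg A_parallel aa).
  by have [aq _ qE] := inW _ Oq; exists (param a q).
pose q0 := coord a x0.
have Oq0 : O q0 by exists x0.
have z0 := phiU _ Oq0.
have dphi := smooth_on_differentiable sphi Oq0.
have dxi := smooth_on_differentiable sxi Oq0.
have lN := normal_deriv_linear Aa dphi dxi (lC _ z0).
pose HN := GRing.isLinear.Build R _ _ _ _ lN.
(* u |-> D_u xi at the point q0 *)
pose N : {linear 'rV[R]_n -> 'rV[R]_(n + p)} :=
  HB.pack (fun u => normal_deriv phi C Aa xia u q0) HN.
have NE u : u *m lin1_mx N = normal_deriv phi C Aa xia u q0.
  by rewrite mul_rV_lin1.
have Nxi u : form (G (phi q0)) (normal_deriv phi C Aa xia u q0) (xia q0) = 0.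
  exact: (normal_deriv_xi oO oU phiU sphi sG compat symG Aa sxi xi1 xiN u Oq0).
have unitG : G (phi q0) \in unitmx by exact: (gram_unit riem ab z0).
have [||u [u0 Nu uJxi]] := exists_null_direction (symG _ z0) (freeP _ Oq0)
  (xi1 _ Oq0) (fun w => xiN _ w Oq0) (JT _ Oq0) (D := lin1_mx N) (erefl _)
  p_lt_n unitG.
- by move=> u w; rewrite NE; exact: weingarten.
- by move=> u; rewrite NE; exact: Nxi.
rewrite NE in Nu.
have [v vE] := holomorphic_tangent (symG _ z0) (xi1 _ Oq0)
  (fun w => xiN _ w Oq0) (JT _ Oq0) uJxi.
have flat := codazzi oO oU phiU sphi sC lC sG compat sJ comm torsion symG sA sxi
  unit_g xi1 xiN weingarten parA Jxi
  (fun q y Oq => J_decomp (JT q Oq) y) v Oq0 Nu.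
rewrite -!(mul_jacobian sphi) // -vE in flat.
apply: (space_form_null (symG _ z0) (JJq _ Oq0) (fun u v => isoq _ u v Oq0)
  (xi1 _ Oq0) (K := curv C (phi q0)) (X := u *m 'J phi q0)).
- move=> w w0; rewrite GE //.
  by have [_ _ _] := riem; apply=> //; exact: chart_b.
- by move=> w w' y; exact: (curv_additive _ _ _ oU z0 sC lC).
- by move=> w y; exact: curv_antisym.
- by move=> w y y'; exact: (curv_bianchi _ _ _ oU z0 sC torsion).
- by move=> w y; exact: (curv_skew _ _ oU z0 sC sG compat).
- by move=> w y; exact: (curv_commute _ _ oU z0 sC sJ comm).
- move=> w; have [->|w0] := eqVneq w 0.
    by rewrite /form trmx0 !mulmx0 !mxE expr0n mulr0.
  have := hol _ _ _ (chart_b _ Oq0) w0.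
  rewrite /sectional_curvature (curvatureE _ _ _ riem (chart_b _ Oq0)).
  rewrite -JE // -GE // isoq //.
  have skew := isometry_skew (JJq _ Oq0) (fun u v => isoq _ u v Oq0) w w.
  have wJw : form (G (phi q0)) w (w *m Jb (phi q0)) = 0.
    by rewrite form_sym ?symG // in skew *; lra.
  rewrite wJw expr0n subr0 => /(canRL (divfK _)) -> //.
  have pos : 0 < form (G (phi q0)) w w.
    by rewrite GE //; have [_ _ _] := riem; apply=> //; exact: chart_b.
  by rewrite mulf_neq0 // gt_eqF.
- apply: contra u0 => /eqP uP; apply/eqP.
  by apply: (row_free_inj (freeP _ Oq0)); rewrite uP mul0mx.
- by rewrite form_sym ?symG // xiN.
- exact: uJxi.
- exact: flat.
Qed.
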